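(* Let $d\ge 2$ be an integer and $m>0$. Consider the Itô stochastic differential equation $$dS_t=\frac{d-1}{2m^2}\,\coth(S_t)\,dt+\frac1m\,dW_t,\qquad S_0=s_0,$$ where $W$ is a standard one-dimensional Wiener process. For every starting point $s_0\in(0,+\infty)$ this equation has a pathwise unique strong solution $S=(S_t,\,t\in\mathbb{R}_+)$ with paths which are $P$-a.s. strictly positive. Moreover, the solutions are transient in the following sense: for every $a>0$ and every initial condition $s_0>a$, the event $\{T_a=+\infty\}$, where $T_a$ is the first hitting time of $a$ by $S$, has strictly positive probability, and on this event $\lim_{t\to+\infty}S_t=+\infty$ $P$-a.s.
   Context: $\mathbb{R}_+=[0,+\infty)$; $T_a=\inf\{t\ge0:\ S_t=a\}$ with $\inf\emptyset=+\infty$. With $b_0(s)=\frac{d-1}{2m^2}\coth(s)$ for $s>0$, a solution is a continuous adapted process $S$ with values in $[0,+\infty)$, a.s. spending zero Lebesgue time at $0$, such that a.s. for all $t\ge 0$, $\int_0^t|b_0(S_r)|\,dr<\infty$ and $S_t=s_0+\int_0^t b_0(S_r)\,dr+\frac1m W_t$. Existence of a strong solution means that for any given standard Wiener process $W$ on the real line there is a solution $S$ adapted to the (completed) filtration generated by $W$. Pathwise uniqueness means that if $S$ and $S'$ are two solutions defined on the same probability space with the same initial condition and the same driving Wiener process $W$, then $P(S_t=S'_t,\ t\in\mathbb{R}_+)=1$. *)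

(* Defs.v *)
From HB Require Import structures.
From mathcomp Require Import all_boot all_order all_algebra.
From mathcomp Require Import all_classical all_reals all_analysis.
From mathcomp Require Import measurable_realfun.

Set Implicit Arguments.
Unset Strict Implicit.
Unset Printing Implicit Defensive.

Import Order.TTheory GRing.Theory Num.Theory.
Import numFieldNormedType.Exports.

Local Open Scope classical_set_scope.
Local Open Scope ring_scope.

(* Processes are functions [X : R -> T -> R] of which only the restriction to
   times [0 <= t] is meaningful.  The probability space is not assumed to be
   complete: [completed_algebra_gen P] is the completion of its sigma-algebra,
   and on the sets of that completion the outer measure [mu_ext P] is the
   completed probability. *)

Section processes.
Context {R : realType} {disp : measure_display} {T : measurableType disp}.
Implicit Types (P : probability T R) (F : R -> set (set T)) (X W S : R -> T -> R).

Definition filtration P F : Prop :=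
  [/\ forall t : R, 0 <= t -> sigma_algebra setT (F t),
      forall t : R, 0 <= t -> F t `<=` completed_algebra_gen P
    & forall s t : R, 0 <= s -> s <= t -> F s `<=` F t].

Definition adapted F X : Prop :=
  forall t : R, 0 <= t -> preimage_set_system setT (X t) measurable `<=` F t.

Definition continuous_path X (w : T) : Prop :=
  {within `[0, +oo[, continuous (fun t => X t w)}.

Definition natural_filtration X (t : R) : set (set T) :=
  <<s \bigcup_(s in `[0, t]) preimage_set_system setT (X s) measurable >>.

Definition completed_filtration P F (t : R) : set (set T) :=
  <<s F t `|` P.-negligible >>.

(* [W] is a standard one-dimensional Wiener process relative to [F].  The second
   parameter of [normal_prob] is the standard deviation. *)
Record wiener_wrt P F W : Prop := WienerWrt {
  wiener_filtration : filtration P F ;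
  wiener_adapted : adapted F W ;
  wiener_start : \forall w \ae P, W 0 w = 0 ;
  wiener_continuous : \forall w \ae P, continuous_path W w ;
  wiener_gaussian : forall s t : R, 0 <= s -> s < t ->
    forall B : set R, measurable B ->
    mu_ext P ((fun w => W t w - W s w) @^-1` B) = normal_prob 0 (Num.sqrt (t - s)) B ;
  wiener_indep : forall s t : R, 0 <= s -> s < t ->
    forall (A : set T) (B : set R), F s A -> measurable B ->
    mu_ext P (A `&` (fun w => W t w - W s w) @^-1` B) =
      (mu_ext P A * mu_ext P ((fun w => W t w - W s w)%R @^-1` B))%E }.

Definition standard_wiener P W : Prop := wiener_wrt P (natural_filtration W) W.

Definition hitting_time X (a : R) (w : T) : \bar R :=
  ereal_inf [set t%:E | t in [set t : R | 0 <= t /\ X t w = a]].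

End processes.

Definition coth {R : realType} (x : R) : R :=
  (expR x + expR (- x)) / (expR x - expR (- x)).

(* The drift is only meaningful for [0 < s]; its value [0] at [s = 0] (from
   division by zero) is immaterial, as solutions spend no time at [0]. *)
Definition b0 {R : realType} (d : nat) (m s : R) : R :=
  (d%:R - 1) / (2 * m ^+ 2) * coth s.

(* [S] solves dS = b0(S) dt + (1/m) dW, S_0 = s0.  The noise being additive, the
   stochastic integral is [m^-1 * W t]. *)
Record sde_solution {R : realType} {disp : measure_display}
    {T : measurableType disp} (d : nat) (m s0 : R) (P : probability T R)
    (F : R -> set (set T)) (W S : R -> T -> R) : Prop := SdeSolution {
  sol_adapted : adapted F S ;
  sol_continuous : forall w, continuous_path S w ;
  sol_ge0 : forall (t : R) (w : T), 0 <= t -> 0 <= S t w ;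
  sol_time0 : \forall w \ae P,
    (@lebesgue_measure R) [set t | 0 <= t /\ S t w = 0] = 0%E ;
  sol_eq : \forall w \ae P, forall t : R, 0 <= t ->
    (@lebesgue_measure R).-integrable `[0, t] (fun r => (b0 d m (S r w))%:E) /\
    S t w = s0 + \int[@lebesgue_measure R]_(r in `[0, t]) b0 d m (S r w)
            + m^-1 * W t w }.

Definition strong_existence_pos {R : realType} (d : nat) (m s0 : R) : Prop :=
  forall (disp : measure_display) (T : measurableType disp)
    (P : probability T R) (W : R -> T -> R),
  standard_wiener P W ->
  exists S : R -> T -> R,
    sde_solution d m s0 P (completed_filtration P (natural_filtration W)) W S /\
    \forall w \ae P, forall t : R, 0 <= t -> 0 < S t w.

(* The two solutions may be adapted to different filtrations, provided [W] is a
   Wiener process relative to each of them. *)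
Definition pathwise_uniqueness {R : realType} (d : nat) (m s0 : R) : Prop :=
  forall (disp : measure_display) (T : measurableType disp)
    (P : probability T R) (F F' : R -> set (set T)) (W S S' : R -> T -> R),
  wiener_wrt P F W -> sde_solution d m s0 P F W S ->
  wiener_wrt P F' W -> sde_solution d m s0 P F' W S' ->
  \forall w \ae P, forall t : R, 0 <= t -> S t w = S' t w.

(* Main.v *)
Require Import Defs.
From HB Require Import structures.
From mathcomp Require Import all_boot all_order all_algebra.
From mathcomp Require Import all_classical all_reals all_analysis.
From mathcomp Require Import measurable_realfun.
From mathcomp Require Import ring lra.

Set Implicit Arguments.
Unset Strict Implicit.
Unset Printing Implicit Defensive.

Import Order.TTheory GRing.Theory Num.Theory.
Import numFieldNormedType.Exports.

Local Open Scope classical_set_scope.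
Local Open Scope ring_scope.

(** The noise is additive and [coth] is decreasing on the half-line, so two
paths solving the equation with the same noise can only get closer: while their
difference is positive, its derivative, the difference of the drifts, is
nonpositive ([integral_crossing]).  This yields pathwise uniqueness, and it also
makes the Euler schemes of the equation with truncated drift
[b0 (max x delta)] uniformly Cauchy on bounded intervals, without any Gronwall
estimate; their limits are adapted solutions of the truncated equation.

That the truncated solution rarely goes below [delta] is shown without Itô
calculus, on the Euler chain itself.  For [d = 2] the function
[- ln (tanh (x / 2)) / 2 = \sum_i exp (- (2 i + 1) x) / (2 i + 1)] is harmonic
for the equation.  Its partial sums are superharmonic on the half-line for all
[d >= 2], they are decreasing on the whole line, and the Gaussian expectation
of an exponential is explicit, so that stopping the chain below [delta] gives a
maximal inequality.  The partial sums of length [N] diverge at [1 / (2 N)] but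
stay bounded at [s0], hence almost surely one of the truncated solutions never
meets its truncation level, and it solves the original equation.

As [coth >= 1], a solution dominates [s0 + k t + W t / m] with
[k = (d - 1) / (2 m^2)].  The maximal inequality, now for a single exponential
and a constant drift, shows that such a path stays above [a] with positive
probability and, applied with drift [k / 2], that it tends to infinity. *)

(** * Gaussian exponential moments and independence *)

(** Change of variables holds for the Radon-Nikodym derivative, which agrees almost everywhere with
    [normal_pdf] because both integrate to the measure of every measurable set. *)
Lemma ge0_integral_normal_prob {R : realType} (m s : R) (f : R -> \bar R) :
  (forall x, 0 <= f x)%E -> measurable_fun setT f ->
  (\int[normal_prob m s]_x f x =
   \int[@lebesgue_measure R]_x (f x * (normal_pdf m s x)%:E))%E.
Proof.
move=> f0 mf.
pose nu := (normal_prob m s : {finite_measure set _ -> \bar R}).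
pose mu := (@lebesgue_measure R : {sigma_finite_measure set _ -> \bar R}).
have dom : nu `<< mu by exact: normal_prob_dominates.
rewrite -[LHS](Radon_Nikodym_SigmaFinite.change_of_variables dom)//.
have mpdf : measurable_fun setT (fun x => (normal_pdf m s x)%:E).
  by apply/measurable_EFinP; exact: measurable_normal_pdf.
have iRN := Radon_Nikodym_SigmaFinite.f_integrable dom.
apply: ae_eq_integral => //.
- by apply: emeasurable_funM => //; exact: measurable_int iRN.
- exact: emeasurable_funM.
- apply: ae_eqe_mul2l; apply: integral_ae_eq => // E _ mE.
  by rewrite -Radon_Nikodym_SigmaFinite.f_integral.
Qed.

(** Completing the square turns the integrand into a constant multiple of the Gaussian density of
    mean [t * s ^+ 2]. *)
Lemma normal_mgf {R : realType} (t s : R) : s != 0 ->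
  (\int[normal_prob 0 s]_x (expR (t * x))%:E = (expR (t ^+ 2 * s ^+ 2 / 2))%:E)%E.
Proof.
move=> s0; rewrite ge0_integral_normal_prob; last 2 first.
- by move=> x; rewrite lee_fin expR_ge0.
- by apply/measurable_EFinP; apply: measurableT_comp => //; exact: measurable_funM.
have E x : ((expR (t * x))%:E * (normal_pdf 0 s x)%:E =
    (expR (t ^+ 2 * s ^+ 2 / 2))%:E * (normal_pdf (t * s ^+ 2) s x)%:E)%E.
  rewrite -!EFinM; congr EFin; rewrite !normal_pdfE// /normal_fun.
  rewrite mulrCA [RHS]mulrCA -!expRD; congr (_ * expR _).
  by field.
under eq_integral do rewrite E.
rewrite ge0_integralZl//.
- by rewrite integral_normal_pdf mule1.
- by apply/measurable_EFinP; exact: measurable_normal_pdf.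
- by move=> x _; rewrite lee_fin normal_pdf_ge0.
Qed.

Section independent_gaussian.
Context {R : realType} {disp : measure_display} {T : measurableType disp}.
Variables (P : probability T R) (G : set (set T)) (Z : T -> R) (s : R).
Hypotheses (sG : sigma_algebra setT G) (subG : G `<=` measurable).
Hypotheses (mZ : measurable_fun setT Z) (s_neq0 : s != 0).
Hypothesis indepZ : forall (A : set T) (B : set R), G A -> measurable B ->
  P (A `&` Z @^-1` B) = (P A * normal_prob 0 s B)%E.

Let Tg := g_sigma_algebraType G.

Let mid : measurable_fun setT (idfun : T -> Tg).
Proof.
by move=> _ A mA; rewrite setTI preimage_id; apply: subG; rewrite -(sigma_algebra_id sG).
Qed.

Let mpair : measurable_fun setT (fun w => (w, Z w) : Tg * measurableTypeR R).
Proof. exact: measurable_fun_pair. Qed.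

(** The type [Tg] carries the sigma-algebra [G], so that [indepZ] says that the joint law of the
    identity into [Tg] and of [Z] is a product measure. Fubini then isolates the Gaussian
    integral. *)
Lemma integral_indep_expR (t : R) (U : Tg -> R) :
  measurable_fun setT U -> (forall w, 0 <= U w) ->
  (\int[P]_w (U w * expR (t * Z w))%:E =
   (expR (t ^+ 2 * s ^+ 2 / 2))%:E * \int[P]_w (U w)%:E)%E.
Proof.
move=> mU U0.
pose idX : {mfun T >-> Tg} := HB.pack (idfun : T -> Tg) (isMeasurableFun.Build _ _ _ _ _ mid).
pose ZX : {mfun T >-> (Tg * measurableTypeR R)%type} :=
  HB.pack (fun w => (w, Z w) : Tg * measurableTypeR R) (isMeasurableFun.Build _ _ _ _ _ mpair).
pose PG : probability Tg R := distribution P idX.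
pose Q : probability (Tg * measurableTypeR R)%type R := distribution P ZX.
pose f (p : Tg * measurableTypeR R) := (U p.1 * expR (t * p.2))%:E.
have mf : measurable_fun setT f.
  apply/measurable_EFinP; apply: measurable_funM; first exact: measurableT_comp.
  by apply: measurableT_comp => //; exact: measurable_funM.
have f0 p : (0 <= f p)%E by rewrite lee_fin mulr_ge0// expR_ge0.
transitivity (\int[Q]_p f p)%E.
  by rewrite ge0_integral_distribution.
transitivity (\int[(PG \x (normal_prob 0 s))%E]_p f p)%E.
  apply: eq_measure_integral => A mA _.
  apply/esym/(@product_measure_unique _ _ _ _ _ PG (normal_prob 0 s) Q) => // B C mB mC.
  rewrite /Q/= /distribution/= /pushforward/=.
  apply: (indepZ _ mC); move: mB; rewrite -[in X in _ -> X](sigma_algebra_id sG).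
  exact.
rewrite (fubini_tonelli1 _ mf)//= /fubini_F.
transitivity (\int[PG]_w ((expR (t ^+ 2 * s ^+ 2 / 2))%:E * (U w)%:E))%E.
  apply: eq_integral => w _; rewrite /f/=.
  under eq_integral do rewrite EFinM.
  rewrite ge0_integralZl//; last 2 first.
  - by apply/measurable_EFinP; apply: measurableT_comp => //; exact: measurable_funM.
  - by rewrite lee_fin.
  by rewrite normal_mgf// muleC.
rewrite ge0_integralZl//; last 2 first.
- exact/measurable_EFinP.
- by move=> w _; rewrite lee_fin.
congr (_ * _)%E.
by rewrite ge0_integral_distribution//; exact/measurable_EFinP.
Qed.

End independent_gaussian.

(** * Adapted Euler chains and their maximal inequality *)

(** The sigma-algebra is changed through the type of the domain, so that the general lemmas on
    measurable functions apply to it. *)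
Definition measurable_wrt {R : realType} {T : pointedType} (G : set (set T)) (f : T -> R) :=
  measurable_fun setT (f : g_sigma_algebraType G -> R).

Lemma measurable_wrtS {R : realType} {T : pointedType} (G G' : set (set T)) (f : T -> R) :
  G `<=` G' -> measurable_wrt G f -> measurable_wrt G' f.
Proof.
move=> GG' mf _ B mB; have := mf measurableT B mB.
exact: (sub_sigma_algebra2 GG').
Qed.

Lemma measurable_wrtP {R : realType} {T : pointedType} (G : set (set T)) (f : T -> R) :
  sigma_algebra setT G ->
  measurable_wrt G f <-> preimage_set_system setT f measurable `<=` G.
Proof.
move=> sG; split=> [mf _ [B mB <-]|sub _ B mB].
  by have := mf measurableT B mB; rewrite -[in X in _ -> X](sigma_algebra_id sG).
by apply: sub_sigma_algebra; apply: sub; exists B.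
Qed.

Lemma measurable_wrt_measurable {R : realType} {d} {T : measurableType d}
    (G : set (set T)) (f : T -> R) :
  sigma_algebra setT G -> G `<=` measurable ->
  measurable_wrt G f -> measurable_fun setT f.
Proof. by move=> sG GT /(measurable_wrtP _ sG) mf _ B mB; apply/GT/mf; exists B. Qed.

(** What the Euler chain uses of a Wiener process, on a space where the filtration consists of
    measurable sets. Taking [A := setT] in [gi_indep] gives the law of the increments. *)
Record gaussian_increments {R : realType} {disp : measure_display}
    {T : measurableType disp} (P : probability T R) (F : R -> set (set T))
    (W : R -> T -> R) : Prop := GaussianIncrements {
  gi_sigma : forall t, 0 <= t -> sigma_algebra setT (F t) ;
  gi_sub : forall t, 0 <= t -> F t `<=` measurable ;
  gi_mono : forall s t, 0 <= s -> s <= t -> F s `<=` F t ;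
  gi_adapted : forall t, 0 <= t -> measurable_wrt (F t) (W t) ;
  gi_indep : forall s t, 0 <= s -> s < t ->
    forall (A : set T) (B : set R), F s A -> measurable B ->
    P (A `&` (fun w => W t w - W s w) @^-1` B) =
      (P A * normal_prob 0 (Num.sqrt (t - s)) B)%E }.

Fixpoint euler {R : realType} (b : R -> R) (x0 h : R) (w : R -> R) (k : nat) : R :=
  if k is j.+1 then
    let x := euler b x0 h w j in x + h * b x + (w (j.+1%:R * h) - w (j%:R * h))
  else x0.

Section euler_chain.
Context {R : realType} {disp : measure_display} {T : measurableType disp}.
Variables (P : probability T R) (F : R -> set (set T)) (W : R -> T -> R).
Hypothesis PW : gaussian_increments P F W.
Variables (m x0 h : R) (b : R -> R).
Hypotheses (m_gt0 : 0 < m) (h_gt0 : 0 < h) (mb : measurable_fun setT b).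

Let X k (w : T) := euler b x0 h (fun t => m^-1 * W t w) k.

Let time_ge0 k : 0 <= k%:R * h. Proof. by rewrite mulr_ge0 ?ler0n ?ltW. Qed.

Let timeS k : k%:R * h < k.+1%:R * h.
Proof. by rewrite ltr_pM2r ?ltr_nat. Qed.

Lemma measurable_euler k : measurable_wrt (F (k%:R * h)) (X k).
Proof.
elim: k => [|k IH]; first exact: measurable_cst.
have IH' := measurable_wrtS (gi_mono PW (time_ge0 k) (ltW (timeS k))) IH.
rewrite /measurable_wrt /X/=; apply: measurable_funD.
  by apply: measurable_funD => //; apply: measurable_funM => //; exact: (measurableT_comp mb IH').
apply: measurable_funB; apply: measurable_funM => //.
  exact: (gi_adapted PW).
apply: (measurable_wrtS _ (gi_adapted PW (time_ge0 k))).
by apply: (gi_mono PW) => //; exact: ltW.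
Qed.

Variables (N : nat) (c l : nat -> R).
Hypotheses (c_ge0 : forall i, 0 <= c i) (l_ge0 : forall i, 0 <= l i).

Let f x := \sum_(i < N) c i * expR (- (l i * x)).

Let f_ge0 x : 0 <= f x.
Proof. by apply: sumr_ge0 => i _; rewrite mulr_ge0 ?expR_ge0. Qed.

Let f_nincr x y : x <= y -> f y <= f x.
Proof.
by move=> xy; apply: ler_sum => i _; rewrite ler_wpM2l// ler_expR lerN2 ler_wpM2l.
Qed.

Let mf : measurable_fun setT f.
Proof.
apply: measurable_sum => i; apply: measurable_funM => //.
by apply: measurableT_comp => //; apply: measurableT_comp => //; exact: measurable_funM.
Qed.

Let mX k : measurable_fun setT (X k).
Proof.
have := @measurable_euler k.
by apply: measurable_wrt_measurable; [exact: (gi_sigma PW)|exact: (gi_sub PW)].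
Qed.

Let dW k w := W (k.+1%:R * h) w - W (k%:R * h) w.

Let mW t : 0 <= t -> measurable_fun setT (W t).
Proof.
move=> t0; have := gi_adapted PW t0.
by apply: measurable_wrt_measurable; [exact: (gi_sigma PW)|exact: (gi_sub PW)].
Qed.

(** The next noise increment has variance [h] and is independent of [F (k%:R * h)], so averaging
    over it produces a constant factor. *)
Lemma integral_euler_expR k (U : T -> R) (t : R) :
  measurable_wrt (F (k%:R * h)) U -> (forall w, 0 <= U w) ->
  (\int[P]_w (U w * expR (t * dW k w))%:E =
   \int[P]_w (expR (t ^+ 2 * h / 2) * U w)%:E)%E.
Proof.
move=> mU U0.
have hE : k.+1%:R * h - k%:R * h = h by rewrite -mulrBl -natrB// subSnn mul1r.
have mUT : measurable_fun setT U.
  by apply: measurable_wrt_measurable mU; [exact: (gi_sigma PW)|exact: (gi_sub PW)].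
rewrite (@integral_indep_expR _ _ _ P (F (k%:R * h)) (dW k) (Num.sqrt h))//.
- rewrite sqr_sqrtr ?ltW//; under [RHS]eq_integral do rewrite EFinM.
  rewrite ge0_integralZl//; first exact/measurable_EFinP.
  by move=> w _; rewrite lee_fin.
- exact: (gi_sigma PW).
- exact: (gi_sub PW).
- by apply: measurable_funB; exact: mW.
- by rewrite gt_eqF// sqrtr_gt0.
- by move=> A B FA mB; rewrite -{1}hE; exact: (gi_indep PW).
Qed.

Variables (delta K : R).
Hypotheses (K_ge0 : 0 <= K) (delta_x0 : delta < x0).
(** The left-hand side is the mean of [f] after one Euler step from [x], the noise of the step
    having variance [h / m ^+ 2]. Thus [f] is superharmonic for the chain up to an error [K] per
    step. *)
Hypothesis step : forall x, delta < x ->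
  \sum_(i < N) c i * expR (- (l i * x)) *
    expR (h * (- (l i * b x) + l i ^+ 2 / (2 * m ^+ 2))) <= f x + K.

Let A k := [set w | forall j, (j <= k)%N -> delta < X j w].

Let FA k : F (k%:R * h) (A k).
Proof.
rewrite (_ : A k = \bigcap_(j in [set j | (j <= k)%N]) (X j @^-1` `]delta, +oo[)); last first.
  by apply/seteqP; split=> w/= H j jk; have := H j jk; rewrite /= in_itv/= andbT.
rewrite -(sigma_algebra_id (gi_sigma PW (time_ge0 k))).
apply: (@bigcap_measurableType _ (g_sigma_algebraType (F (k%:R * h)))).
move=> j jk; rewrite -[X in measurable X]setTI.
apply: (measurable_wrtS _ (@measurable_euler j)) => //.
by apply: (gi_mono PW) => //; rewrite ler_pM2r// ler_nat.
Qed.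

Let mA k : measurable (A k).
Proof. by apply: (gi_sub PW (time_ge0 k)); exact: FA. Qed.

(* [f] along the chain frozen at [delta] once the chain has gone below [delta];
since [f] is nonincreasing, freezing only decreases it. *)
Let stopped k (w : T) := if w \in A k then f (X k w) else f delta.

Let mif k (g : T -> R) : measurable_fun setT g ->
  measurable_fun setT (fun w => if w \in A k then g w else f delta).
Proof.
move=> mg; apply: measurable_fun_ifT => //.
apply: (measurable_fun_bool true); rewrite setTI [X in measurable X](_ : _ = A k)//.
by apply/seteqP; split=> w /=; [move/set_mem|move/mem_set].
Qed.

(** The event [A k] and the position after the drift are known at time [k%:R * h], so the increment
    is averaged out of each exponential separately; on [A k] the resulting sum is bounded by
    [step]. *)
Let step_integral k :
  (\int[P]_w (\1_(A k) w * f (X k.+1 w))%:E <=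
   \int[P]_w (\1_(A k) w * (f (X k w) + K))%:E)%E.
Proof.
pose U i w := \1_(A k) w * (c i * expR (- (l i * (X k w + h * b (X k w))))).
have mXk := @measurable_euler k.
have mU i : measurable_wrt (F (k%:R * h)) (U i).
  apply: measurable_funM.
    by apply: measurable_indic; apply: sub_sigma_algebra; exact: FA.
  apply: measurable_funM => //; apply: measurableT_comp => //.
  apply: measurableT_comp => //; apply: measurable_funM => //.
  apply: measurable_funD => //; apply: measurable_funM => //.
  exact: (measurableT_comp mb mXk).
have U0 i w : 0 <= U i w by rewrite mulr_ge0// mulr_ge0// expR_ge0.
have mUT i : measurable_fun setT (U i).
  by apply: measurable_wrt_measurable (mU i); [exact: (gi_sigma PW)|exact: (gi_sub PW)].
have mdW : measurable_fun setT (dW k) by apply: measurable_funB; exact: mW.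
have -> : (\int[P]_w (\1_(A k) w * f (X k.+1 w))%:E =
    \int[P]_w \sum_(i < N) (U i w * expR (- (l i / m) * dW k w))%:E)%E.
  apply: eq_integral => w _; rewrite sumEFin; congr EFin.
  rewrite /f mulr_sumr; apply: eq_bigr => i _; rewrite /U -!mulrA; congr (_ * (_ * _)).
  by rewrite -expRD; congr expR; rewrite /X/= -/(X k w) /dW; ring.
rewrite ge0_integral_sum//; last 2 first.
- move=> i; apply/measurable_EFinP; apply: measurable_funM => //.
  by apply: measurableT_comp => //; exact: measurable_funM.
- by move=> i w _; rewrite lee_fin mulr_ge0// expR_ge0.
under eq_bigr do rewrite integral_euler_expR//.
rewrite -ge0_integral_sum//; last 2 first.
- by move=> i; apply/measurable_EFinP; exact: measurable_funM.
- by move=> i w _; rewrite lee_fin mulr_ge0// expR_ge0.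
apply: ge0_le_integral => //.
- by move=> w _; apply: sume_ge0 => i _; rewrite lee_fin mulr_ge0// expR_ge0.
- by apply: emeasurable_sum => i; apply/measurable_EFinP; exact: measurable_funM.
- apply/measurable_EFinP; apply: measurable_funM => //.
  by apply: measurable_funD => //; exact: measurableT_comp.
move=> w _; rewrite sumEFin lee_fin indicE.
have [wA|wA] := boolP (w \in A k); last first.
  by rewrite mul0r big1// => i _; rewrite /U indicE (negbTE wA) mul0r mulr0.
rewrite mul1r; have wd : delta < X k w by move: wA; rewrite inE; exact.
apply: le_trans (step wd); apply: ler_sum => i _.
rewrite /U indicE wA mul1r [leLHS]mulrCA -[leRHS]mulrA -!expRD ler_wpM2l// ler_expR.
by rewrite le_eqVlt; apply/orP; left; apply/eqP; field; rewrite gt_eqF.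
Qed.

Let stopped_integral k :
  (\int[P]_w (stopped k w)%:E <= (f x0 + k%:R * K)%:E)%E.
Proof.
elim: k => [|k IH].
  rewrite mul0r addr0 (eq_integral (cst (f x0)%:E)).
    by rewrite integral_cst//= probability_setT mule1.
  move=> w _; rewrite /stopped ifT// inE => j; rewrite leqn0 => /eqP ->.
  exact: delta_x0.
have I0 w : 0 <= \1_(A k) w :> R by [].
have I1 w : \1_(A k) w <= 1 :> R by rewrite indicE; case: (_ \in _).
have mI : measurable_fun setT (\1_(A k) : T -> R) by exact: measurable_indic.
have mI' : measurable_fun setT (fun w => (1 - \1_(A k) w) * f delta).
  by apply: measurable_funM => //; exact: measurable_funB.
have mfX j : measurable_fun setT (fun w => f (X j w)) by exact: measurableT_comp.
have step1 : (\int[P]_w (stopped k.+1 w)%:E <=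
   \int[P]_w ((\1_(A k) w * f (X k.+1 w))%:E + ((1 - \1_(A k) w) * f delta)%:E))%E.
  apply: ge0_le_integral => //.
  - by move=> w _; rewrite lee_fin /stopped; case: ifP => _; exact: f_ge0.
  - by apply/measurable_EFinP; exact: mif.
  - apply: emeasurable_funD; apply/measurable_EFinP => //.
    exact: measurable_funM.
  move=> w _; rewrite -EFinD lee_fin /stopped indicE.
  have [wA|/negP wA] := boolP (w \in A k.+1).
    have -> : w \in A k.
      by move: wA; rewrite !inE => H j jk; apply: H; exact: leq_trans jk _.
    by rewrite mul1r subrr mul0r addr0.
  have [wAk|_] := boolP (w \in A k); last by rewrite mul0r add0r subr0 mul1r.
  rewrite mul1r subrr mul0r addr0; apply: f_nincr; rewrite leNgt; apply/negP => lt.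
  apply: wA; rewrite inE => j; rewrite leq_eqVlt => /orP[/eqP -> //|].
  by rewrite ltnS; move: wAk; rewrite inE; exact.
apply: (le_trans step1).
rewrite ge0_integralD//; last 4 first.
- by move=> w _; rewrite lee_fin mulr_ge0.
- by apply/measurable_EFinP; exact: measurable_funM.
- by move=> w _; rewrite lee_fin mulr_ge0// subr_ge0.
- exact/measurable_EFinP.
apply: le_trans (leeD2r _ (step_integral k)) _.
rewrite -ge0_integralD//; last 4 first.
- by move=> w _; rewrite lee_fin mulr_ge0// addr_ge0.
- by apply/measurable_EFinP; apply: measurable_funM => //; exact: measurable_funD.
- by move=> w _; rewrite lee_fin mulr_ge0// subr_ge0.
- exact/measurable_EFinP.
apply: (@le_trans _ _ (\int[P]_w ((stopped k w)%:E + K%:E))%E).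
  apply: ge0_le_integral => //.
  - by move=> w _; rewrite -EFinD lee_fin addr_ge0// mulr_ge0// ?addr_ge0// subr_ge0.
  - apply: emeasurable_funD; apply/measurable_EFinP => //.
    by apply: measurable_funM => //; exact: measurable_funD.
  - by apply: emeasurable_funD => //; apply/measurable_EFinP; exact: mif.
  move=> w _; rewrite -!EFinD lee_fin /stopped indicE.
  case: (w \in A k); first by rewrite mul1r subrr mul0r addr0.
  by rewrite mul0r add0r subr0 mul1r lerDl.
rewrite ge0_integralD//; last 2 first.
- by move=> w _; rewrite lee_fin /stopped; case: ifP => _; exact: f_ge0.
- by apply/measurable_EFinP; exact: mif.
rewrite integral_cst//= probability_setT mule1 -natr1 mulrDl mul1r addrA EFinD.
exact: leeD2r.
Qed.

(** Markov's inequality for [stopped n], which equals [f delta] outside [A n]. *)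
Lemma euler_maximal n :
  measurable [set w | exists2 j, (j <= n)%N & X j w <= delta] /\
  ((f delta)%:E * P [set w | exists2 j, (j <= n)%N & (X j w <= delta)%R] <=
   (f x0 + n%:R * K)%:E)%E.
Proof.
have -> : [set w | exists2 j, (j <= n)%N & X j w <= delta] = ~` A n.
  apply/seteqP; split=> w /=; first by move=> [j jn Xj] /(_ j jn); rewrite ltNge Xj.
  by move=> /existsNP[j /not_implyP[jn /negP]]; rewrite -leNgt; exists j.
split; first exact: measurableC.
apply: le_trans (stopped_integral n).
rewrite -[P _]mul1e -integral_cst//; last exact: measurableC.
rewrite -ge0_integralZl//; last 2 first.
- exact: measurableC.
- by rewrite lee_fin f_ge0.
rewrite integral_mkcond; apply: ge0_le_integral => //.
- by move=> w _; rewrite patchE; case: ifP => // _; rewrite mule1 lee_fin f_ge0.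
- by apply/(measurable_restrictT _ _).1 => //; exact: measurableC.
- by apply/measurable_EFinP; apply: mif; exact: measurableT_comp.
move=> w _; rewrite patchE in_setC /stopped.
by case: (w \in A n) => /=; rewrite ?mule1 ?lee_fin ?f_ge0.
Qed.
End euler_chain.

(* The [Hint Extern] of the library does not find the measure structure of
[lebesgue_measure] by unification. *)
Lemma ae_filter_lebesgue {R : realType} :
  Filter (almost_everywhere (@lebesgue_measure R)).
Proof. exact: (ae_filter_ringOfSetsType (@lebesgue_measure R)). Qed.
#[global] Hint Extern 0 (Filter (nbhs (almost_everywhere _))) =>
  exact: ae_filter_lebesgue : typeclass_instances.

(** * Comparison of integral paths *)

Lemma ae_le_Rintegral {d} {T : measurableType d} {R : realType}
    (mu : {measure set T -> \bar R}) (D : set T) (f g : T -> R) :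
  measurable D -> mu.-integrable D (EFin \o f) -> mu.-integrable D (EFin \o g) ->
  (\forall r \ae mu, D r -> f r <= g r) ->
  \int[mu]_(r in D) f r <= \int[mu]_(r in D) g r.
Proof.
move=> mD fi gi fg; rewrite -subr_ge0 -RintegralB// /Rintegral fine_ge0//.
have mf : measurable_fun D f by apply/measurable_EFinP; exact: measurable_int fi.
have mg : measurable_fun D g by apply/measurable_EFinP; exact: measurable_int gi.
(* Almost everywhere the difference equals its positive part, which is nonnegative at every
   point. *)
rewrite (@ae_eq_integral _ _ _ mu D (fun r => (Num.max (g r - f r) 0)%:E))//.
- by apply: integral_ge0 => r _; rewrite lee_fin le_max lexx orbT.
- by apply/measurable_EFinP; exact: measurable_funB.
- by apply/measurable_EFinP; apply: measurable_maxr => //; exact: measurable_funB.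
- apply: filterS fg => r fg Dr; congr EFin; rewrite max_l// subr_ge0; exact: fg.
Qed.

Section crossing.
Context {R : realType}.
Local Notation mu := (@lebesgue_measure R).
Variables (g : R -> R) (T K : R).
Hypotheses (ig : mu.-integrable `[0, T] (EFin \o g)).
Let D t := \int[mu]_(r in `[0, t]) g r.

(** If [D t1 > K], let [t0] be the last time before [t1] at which [D] is at most [K]; it exists by
    continuity. On []t0, t1]] the integrand is nonpositive, whence [D t1 <= D t0 <= K]. *)
Lemma integral_crossing : 0 <= K ->
  (\forall r \ae mu, 0 <= r <= T -> K < D r -> g r <= 0) ->
  forall t, 0 <= t <= T -> D t <= K.
Proof.
move=> K0 gK t1 /andP[t10 t1T]; rewrite leNgt; apply/negP => Kt1.
have T0 : 0 <= T by exact: le_trans t1T.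
have cD : {within `[0, T], continuous D}.
  exact: parameterized_integral_continuous.
have D0 : D 0 = 0 by rewrite /D set_itv1 Rintegral_set1.
pose E := [set s | 0 <= s <= t1 /\ D s <= K].
have E0 : E 0 by rewrite /E/= lexx t10 D0.
have supE : has_sup E by split; [exists 0|exists t1 => s [/andP[]]].
set t0 := sup E.
have t00 : 0 <= t0 by exact: sup_upper_bound.
have t0t1 : t0 <= t1 by apply: ge_sup; [exists 0|move=> s [/andP[]]].
have Dt0 : D t0 <= K.
  rewrite leNgt; apply/negP => Kt0.
  have /subspace_continuousP/(_ t0) := cD.
  rewrite /= in_itv/= t00 (le_trans t0t1 t1T) => /(_ isT).
  move=> /cvgrPdist_lt/(_ (D t0 - K)); rewrite subr_gt0 => /(_ Kt0).
  rewrite near_withinE near_nbhs => /nbhs_ballP[e /= e0 He].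
  have [s [/andP[s0 st1] DsK] t0s] := sup_adherent e0 supE.
  have st0 : s <= t0 by apply: sup_upper_bound => //; rewrite /E/= s0 st1.
  have := He s; rewrite /ball/= in_itv/= s0 (le_trans st1 t1T) => /(_ _ isT).
  rewrite ger0_norm ?subr_ge0// ltrBlDl -ltrBlDr => /(_ t0s).
  rewrite real_ltr_norml ?num_real// => /andP[_].
  by rewrite ltrD2l ltrN2 ltNge DsK.
have i1 : mu.-integrable `[0, t1] (EFin \o g).
  by apply: integrableS ig => //; apply: subset_itvl; rewrite bnd_simp.
have i01 : mu.-integrable `]t0, t1] (EFin \o g).
  by apply: integrableS i1 => //; apply: subset_itvr; rewrite bnd_simp.
have := @Rintegral_itvB _ g (BLeft 0) (BRight t1) t0 i1.
rewrite !bnd_simp => /(_ t00 t0t1); rewrite -/(D t1) -/(D t0) => DE.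
have : \int[mu]_(r in `]t0, t1]) g r <= 0.
  have -> : 0 = \int[mu]_(r in `]t0, t1]) (0 : R) by rewrite Rintegral_cst// mul0r.
  apply: ae_le_Rintegral => //; first exact: integrable0.
  move: gK; apply: filterS => r gK; rewrite /= in_itv/= => /andP[t0r rt1].
  have r0 : 0 <= r by exact: le_trans (ltW t0r).
  apply: gK; first by rewrite r0 (le_trans rt1).
  rewrite ltNge; apply/negP => DrK; move: t0r; rewrite ltNge => /negP; apply.
  by apply: sup_upper_bound => //; rewrite /E/= r0 rt1.
rewrite -DE subr_le0 => /le_trans/(_ Dt0).
by rewrite leNgt Kt1.
Qed.

End crossing.
(** [integral_crossing] for the difference of the two drifts. The slack [K] will absorb the distance
    between a scheme and its interpolation; it is 0 for exact solutions. *)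
Lemma integral_compare {R : realType} (g g' x x' : R -> R) (T K : R) :
  0 <= K ->
  (@lebesgue_measure R).-integrable `[0, T] (EFin \o g) ->
  (@lebesgue_measure R).-integrable `[0, T] (EFin \o g') ->
  (forall t, 0 <= t <= T -> x t - x' t =
     \int[@lebesgue_measure R]_(r in `[0, t]) g r -
     \int[@lebesgue_measure R]_(r in `[0, t]) g' r) ->
  (\forall r \ae (@lebesgue_measure R), 0 <= r <= T -> x' r + K < x r -> g r <= g' r) ->
  forall t, 0 <= t <= T -> x t <= x' t + K.
Proof.
move=> K0 ig ig' xE gg'.
have intE t : 0 <= t <= T ->
    \int[@lebesgue_measure R]_(r in `[0, t]) (g r - g' r) = x t - x' t.
  move=> /andP[t0 tT]; rewrite xE ?t0// RintegralB//.
  - by apply: integrableS ig => //; apply: subset_itvl; rewrite bnd_simp.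
  - by apply: integrableS ig' => //; apply: subset_itvl; rewrite bnd_simp.
move=> t t0T; rewrite -lerBlDl -intE//; move: t t0T.
apply: (@integral_crossing _ (fun r => g r - g' r) T K) => //.
  rewrite (_ : _ \o _ = (EFin \o g) \- (EFin \o g'))%E; last exact/funext.
  exact: integrableB.
move: gg'; apply: filterS => r gg' r0T; rewrite intE// => lt.
by rewrite subr_le0 gg'// -ltrBrDl.
Qed.

(** * Convergence of the Euler schemes along a fixed path *)

Lemma truncn_div {R : archiRealFieldType} (h r : R) (k : nat) :
  0 < h -> k%:R * h <= r < k.+1%:R * h -> Num.truncn (r / h) = k.
Proof.
by move=> h0 /andP[r1 r2]; apply: truncn_def; rewrite ler_pdivlMr// r1 ltr_pdivrMr.
Qed.

Lemma truncn_div_itv {R : archiRealFieldType} (h r : R) : 0 < h -> 0 <= r ->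
  (Num.truncn (r / h))%:R * h <= r < (Num.truncn (r / h)).+1%:R * h.
Proof.
move=> h0 r0; have : 0 <= r / h by rewrite divr_ge0 // ltW.
by move=> /truncn_itv/andP[r1 r2]; rewrite -ler_pdivlMr// r1 -ltr_pdivrMr.
Qed.

Lemma measurable_seq_truncn {R : realType} (u : nat -> R) (h : R) (D : set R) :
  0 < h -> (forall r, D r -> 0 <= r) ->
  measurable_fun D (fun r => u (Num.truncn (r / h))).
Proof.
move=> h0 D0 mD B mB.
rewrite (_ : _ `&` _ =
    \bigcup_(k in [set k | B (u k)]) (D `&` `[k%:R * h, k.+1%:R * h[%classic)).
  by apply: bigcup_measurable => k _; apply: measurableI => //; exact: measurable_itv.
apply/seteqP; split=> r /=.
  move=> [Dr Br]; exists (Num.truncn (r / h)) => //=.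
  by rewrite in_itv/= truncn_div_itv// D0.
by move=> [k /= Bk]; rewrite in_itv/= => -[Dr kr]; rewrite (truncn_div h0 kr).
Qed.

(** Heine's theorem, from the near-covering form of compactness. *)
Lemma continuous_unif_itv {R : realType} (w : R -> R) (T e : R) : continuous w ->
  0 < e -> exists2 d, 0 < d &
    forall s t, 0 <= s <= T -> 0 <= t <= T -> `|s - t| < d -> `|w s - w t| < e.
Proof.
move=> cw e0.
have /compact_near_coveringP/(_ R (0^'+)) := @segment_compact R 0 T.
move=> /(_ (fun d x => forall s, `|s - x| < d -> `|w s - w x| < e)) [].
  move=> x _; have /cvgrPdist_lt/(_ (e / 2)) := cw x.
  rewrite divr_gt0// => /(_ isT)/nbhs_ballP[d /= d0 Hd].
  exists (ball x (d / 2), [set d' | 0 < d'] `&` [set d' | d' < d / 2]); rewrite /=.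
    split; first by apply: nbhsx_ballx; rewrite divr_gt0.
    by apply: filterI; [exact: nbhs_right_gt|apply: nbhs_right_lt; rewrite divr_gt0].
  move=> [y d'] /= [xy [d'0 d'd]] s sy.
  have xs : `|w x - w s| < e / 2.
    apply: Hd; rewrite /ball/=; move: xy; rewrite /ball/= => xy.
    rewrite (le_lt_trans (ler_distD y _ _))// (splitr d) ltrD// distrC.
    exact: lt_trans d'd.
  have xy' : `|w x - w y| < e / 2.
    apply: Hd; move: xy; rewrite /ball/= => /lt_trans; apply.
    by rewrite ltr_pdivrMr// ltr_pMr// ltr1n.
  by rewrite (le_lt_trans (ler_distD (w x) _ _))// (splitr e) ltrD// distrC.
move=> d /= d0 Hd; near (0 : R)^'+ => d'.
exists d' => // s t sT tT std; apply: (Hd d') => //.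
  rewrite /ball/= sub0r normrN gtr0_norm//; near: d'; exact: nbhs_right_lt.
Unshelve. all: by end_near. Qed.

Section euler_path.
Context {R : realType}.
Local Notation mu := (@lebesgue_measure R).
Variables (b w : R -> R) (x0 M : R).
Hypotheses (b_nincr : {homo b : x y /~ x <= y}) (b_cont : continuous b).
Hypotheses (b_bound : forall x, `|b x| <= M) (w_cont : continuous w).

Definition euler_step (h r : R) : R := euler b x0 h w (Num.truncn (r / h)).

(** Interpolation of the scheme that freezes only the drift at the last grid point. It satisfies an
    integral equation with the full noise, so that the noise cancels when two meshes are
    compared. *)
Let interp (h t : R) : R :=
  x0 + \int[mu]_(r in `[0, t]) b (euler_step h r) + (w t - w 0).

Let M0 : 0 <= M. Proof. exact: le_trans (normr_ge0 _) (b_bound 0). Qed.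

Let mb : measurable_fun setT b. Proof. exact: continuous_measurable_fun. Qed.

Lemma integrable_bounded_itv (f : R -> R) (s t : R) :
  measurable_fun `[s, t] f -> (forall r, `|f r| <= M) ->
  mu.-integrable `[s, t] (EFin \o f).
Proof.
move=> mf fM; apply: measurable_bounded_integrable => //.
- by rewrite /= lebesgue_measure_itv/=; case: ifP => //; rewrite -EFinD ltry.
- exists M; split; first exact: num_real.
  by move=> x Mx r _; apply: le_trans (fM r) _; exact: ltW.
Qed.

Let ib h s t : 0 < h -> 0 <= s ->
  mu.-integrable `[s, t] (EFin \o (fun r => b (euler_step h r))).
Proof.
move=> h0 s0; apply: integrable_bounded_itv => //.
apply: (@measurable_seq_truncn _ (fun k => b (euler b x0 h w k))) => // r.
by rewrite /= in_itv/= => /andP[+ _]; exact: le_trans.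
Qed.

Let interp_cell h k t : 0 < h -> k%:R * h <= t <= k.+1%:R * h ->
  interp h t - interp h (k%:R * h) =
  (t - k%:R * h) * b (euler b x0 h w k) + (w t - w (k%:R * h)).
Proof.
move=> h0 /andP[kt tk]; have k0 : 0 <= k%:R * h by rewrite mulr_ge0// ltW.
have := @Rintegral_itvB _ (b \o euler_step h) (BLeft 0) (BRight t) (k%:R * h) (ib _ h0 (lexx 0)).
rewrite !bnd_simp => /(_ k0 kt) /= intE.
suff : \int[mu]_(r in `]k%:R * h, t]) (b \o euler_step h) r =
    (t - k%:R * h) * b (euler b x0 h w k).
  by rewrite /interp -intE /= => <-; ring.
(* The endpoint [t] may be the next grid point, where the scheme has already jumped; without it the
   integrand is constant. *)
rewrite -Rintegral_itv_bndo_bndc; last first.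
  by apply: integrableS (ib t h0 k0) => //; apply: subset_itv; rewrite bnd_simp.
rewrite (@eq_Rintegral _ _ _ _ _ (fun=> b (euler b x0 h w k))); last first.
  move=> r; rewrite inE/= in_itv/= => /andP[kr rt]; congr b; congr euler.
  by apply: truncn_div => //; rewrite (ltW kr) (lt_le_trans rt).
rewrite Rintegral_cst//= lebesgue_measure_itv/= lte_fin mulrC.
have [lt|le] := ltP; first by [].
by rewrite (_ : t = k%:R * h) ?subrr ?mul0r//; apply/eqP; rewrite eq_le le kt.
Qed.

Let interp_grid h k : 0 < h -> interp h (k%:R * h) = euler b x0 h w k.
Proof.
move=> h0; elim: k => [|k IH].
  by rewrite mul0r /interp set_itv1 Rintegral_set1 subrr !addr0.
have kk : k%:R * h <= k.+1%:R * h by rewrite ler_pM2r// ler_nat.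
have := @interp_cell h k (k.+1%:R * h) h0; rewrite kk lexx => /(_ isT) /eqP.
rewrite IH subr_eq => /eqP -> /=; rewrite -(natr1 k).
by ring.
Qed.

Let interp_dist h t : 0 < h -> 0 <= t ->
  `|interp h t - euler_step h t| <=
    h * M + `|w t - w ((Num.truncn (t / h))%:R * h)|.
Proof.
move=> h0 t0; have /andP[kt tk] := truncn_div_itv h0 t0.
rewrite /euler_step -interp_grid// interp_cell//; last by rewrite kt ltW.
rewrite (le_trans (ler_normD _ _))// lerD2r normrM ler_pM//.
rewrite ger0_norm ?subr_ge0// lerBlDl ltW//.
by rewrite (lt_le_trans tk)// -natr1 mulrDl mul1r addrC.
Qed.

(* [(n + 1)^3] steps of this mesh cover [[0, n + 1]], while an error of the
order of the squared mesh at each step still adds up to [O (1 / (n + 1))]. *)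
Definition euler_mesh (n : nat) : R := (n.+1%:R ^+ 2)^-1.

Lemma euler_mesh_gt0 n : 0 < euler_mesh n.
Proof. by rewrite invr_gt0 exprn_gt0. Qed.

Lemma euler_mesh_lt (e : R) : 0 < e -> \forall n \near \oo, euler_mesh n < e.
Proof.
move=> e0; near=> n.
apply: (@le_lt_trans _ _ (n.+1%:R^-1)).
  by rewrite lef_pV2 ?posrE ?exprn_gt0// ler_eXnr// ler1n.
by near: n; exact: near_infty_natSinv_lt (PosNum e0).
Unshelve. all: by end_near. Qed.

(** Inside a cell the interpolation moves by at most [h * M] plus an oscillation of [w], which is
    uniformly small on [[0, T]]. *)
Let interp_close T e : 0 < e -> \forall n \near \oo,
  forall t, 0 <= t <= T -> `|interp (euler_mesh n) t - euler_step (euler_mesh n) t| <= e.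
Proof.
move=> e0; have e20 : 0 < e / 2 by rewrite divr_gt0.
have [d d0 Hd] := continuous_unif_itv T w_cont e20.
near=> n.
have hM : euler_mesh n < e / 2 / (M + 1).
  by near: n; apply: euler_mesh_lt; rewrite divr_gt0// ltr_wpDl.
have hd : euler_mesh n < d by near: n; exact: euler_mesh_lt.
have h0 : 0 < euler_mesh n by exact: euler_mesh_gt0.
set h := euler_mesh n in hM hd h0 *.
move=> t /andP[t0 tT].
apply: le_trans (interp_dist h0 t0) _; rewrite [leRHS]splitr lerD//.
  rewrite (@le_trans _ _ (h * (M + 1)))//; first by rewrite ler_pM2l// lerDl.
  by rewrite -ler_pdivlMr ?ltW// ltr_wpDl.
have /andP[kt tk] := truncn_div_itv h0 t0.
apply/ltW/Hd; first by rewrite t0.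
  by rewrite mulr_ge0 ?(ltW h0)//= (le_trans kt).
rewrite ger0_norm ?subr_ge0//; apply: (@lt_trans _ _ h).
  by rewrite ltrBlDl (lt_le_trans tk)// -natr1 mulrDl mul1r.
exact: hd.
Unshelve. all: by end_near. Qed.

(** When the first interpolation exceeds the second by more than [e + e], the schemes are in the
    same order, and the nonincreasing [b] brings the interpolations closer. *)
Let interp_le T e h h' : 0 <= e -> 0 < h -> 0 < h' ->
  (forall t, 0 <= t <= T -> `|interp h t - euler_step h t| <= e) ->
  (forall t, 0 <= t <= T -> `|interp h' t - euler_step h' t| <= e) ->
  forall t, 0 <= t <= T -> interp h t <= interp h' t + (e + e).
Proof.
move=> e0 h0 h'0 he h'e.
apply: (@integral_compare _ (b \o euler_step h) (b \o euler_step h')).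
- by rewrite addr_ge0.
- exact: ib.
- exact: ib.
- by move=> t _; rewrite /interp /=; ring.
- apply/aeW => r r0T lt; apply: b_nincr; rewrite leNgt; apply/negP => lt'.
  have := he r r0T; have := h'e r r0T; rewrite !ler_norml.
  by move=> /andP[? ?] /andP[? ?]; lra.
Qed.

Let step_cauchy T e : 0 < e -> \forall N \near \oo, forall n n', (N <= n)%N -> (N <= n')%N ->
  forall t, 0 <= t <= T ->
  `|euler_step (euler_mesh n) t - euler_step (euler_mesh n') t| <= e.
Proof.
(* One quarter for each scheme against its interpolation, and two quarters between the
   interpolations. *)
move=> e0; have e40 : 0 < e / 4 by rewrite divr_gt0.
have [N _ HN] := @interp_close T _ e40.
exists N => // N' /= NN' n n' N'n N'n' t tT.
have Hn := HN n (leq_trans NN' N'n).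
have Hn' := HN n' (leq_trans NN' N'n').
have mn := euler_mesh_gt0 n; have mn' := euler_mesh_gt0 n'.
have := interp_le (ltW e40) mn mn' Hn Hn' tT.
have := interp_le (ltW e40) mn' mn Hn' Hn tT.
have := Hn t tT; have := Hn' t tT; rewrite !ler_norml.
move=> /andP[? ?] /andP[? ?] ? ?; apply/andP; split; lra.
Qed.

Definition euler_limit (t : R) : R := limn (fun n => euler_step (euler_mesh n) t).

Lemma euler_limit_cvg t : 0 <= t -> euler_step (euler_mesh n) t @[n --> \oo] --> euler_limit t.
Proof.
move=> t0; apply: R_complete; apply: cauchy_exP => e e0 /=.
have e20 : 0 < e / 2 by rewrite divr_gt0.
have [N _ HN] := @step_cauchy t _ e20.
exists (euler_step (euler_mesh N) t); exists N => // n /= Nn.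
rewrite /ball/=; apply: le_lt_trans (HN N (leqnn N) N n (leqnn N) Nn t _) _.
  by rewrite t0 lexx.
by rewrite ltr_pdivrMr// ltr_pMr// ltr1n.
Qed.

(** Dominated convergence, with the constant bound [M], in the equation of the interpolations, which
    have the same limit as the schemes. *)
Lemma euler_limit_integral_eq t : 0 <= t ->
  mu.-integrable `[0, t] (fun r => (b (euler_limit r))%:E) /\
  euler_limit t = x0 + \int[mu]_(r in `[0, t]) b (euler_limit r) + (w t - w 0).
Proof.
move=> t0; pose f n r := (b (euler_step (euler_mesh n) r))%:E.
have mf n : measurable_fun `[0, t] (f n).
  exact: measurable_int (ib t (euler_mesh_gt0 n) (lexx 0)).
have fcvg r : `[0, t]%classic r -> f n r @[n --> \oo] --> (b (euler_limit r))%:E.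
  rewrite /= in_itv/= => /andP[r0 _]; apply/fine_cvgP; split; first exact: nearW.
  by apply: continuous_cvg; [exact: b_cont|exact: euler_limit_cvg].
have mlim : measurable_fun `[0, t] (fun r => (b (euler_limit r))%:E).
  exact: emeasurable_fun_cvg mf fcvg.
have icst : mu.-integrable `[0, t] (fun=> M%:E).
  apply: (@integrable_bounded_itv (fun=> M)) => //.
  by move=> r; rewrite ger0_norm.
have [] := @dominated_convergence _ _ _ mu `[0, t] _ f (fun r => (b (euler_limit r))%:E)
    (fun=> M%:E) mf mlim _ icst _.
- exact: measurable_itv.
- exact: aeW.
- by apply: aeW => r n _; exact: b_bound.
move=> ilim _ intcvg.
split=> //.
have lim1 : interp (euler_mesh n) t @[n --> \oo] -->
    x0 + \int[mu]_(r in `[0, t]) b (euler_limit r) + (w t - w 0).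
  apply: cvgD; last exact: cvg_cst.
  apply: cvgD; first exact: cvg_cst.
  apply: fine_cvg; rewrite fineK; first exact: intcvg.
  exact: integrable_fin_num.
have lim2 : interp (euler_mesh n) t @[n --> \oo] --> euler_limit t.
  have := euler_limit_cvg t0.
  suff : interp (euler_mesh n) t - euler_step (euler_mesh n) t @[n --> \oo] --> 0.
    move=> d0 dl; rewrite -[X in _ --> X]add0r.
    rewrite (_ : (fun n => interp (euler_mesh n) t) = (fun n =>
      interp (euler_mesh n) t - euler_step (euler_mesh n) t + euler_step (euler_mesh n) t)).
      exact: cvgD.
    by apply/funext => n; rewrite subrK.
  apply/cvgr0Pnorm_le => e e0; have := @interp_close t _ e0.
  by apply: filterS => n; apply; rewrite t0 lexx.
by have := cvg_unique _ lim2 lim1; exact.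
Qed.

End euler_path.

(** * Maximal inequality for the limit of the schemes *)

Section limit_maximal.
Context {R : realType} {disp : measure_display} {T : measurableType disp}.
Variables (P : probability T R) (F : R -> set (set T)) (W : R -> T -> R).
Hypothesis PW : gaussian_increments P F W.
Variables (m x0 M : R) (b : R -> R).
Hypotheses (m_gt0 : 0 < m) (b_nincr : {homo b : x y /~ x <= y}) (b_cont : continuous b).
Hypothesis b_bound : forall x, `|b x| <= M.
Variables (N : nat) (c l : nat -> R) (delta K : R).
Hypotheses (c_ge0 : forall i, 0 <= c i) (l_ge0 : forall i, 0 <= l i).
Hypotheses (K_ge0 : 0 <= K) (delta_x0 : delta < x0).
Let f x := \sum_(i < N) c i * expR (- (l i * x)).
Hypothesis step : \forall n \near \oo, forall x, delta < x ->
  \sum_(i < N) c i * expR (- (l i * x)) *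
    expR (euler_mesh n * (- (l i * b x) + l i ^+ 2 / (2 * m ^+ 2))) <=
  f x + K * euler_mesh n ^+ 2.

Let path w t := m^-1 * W t w.

Let hit n := [set w | exists2 j, (j <= n.+1 ^ 3)%N &
  euler b x0 (euler_mesh n) (path w) j <= delta].

Let hit_bound : \forall n \near \oo, measurable (hit n) /\
  ((f delta)%:E * P (hit n) <= (f x0 + K / n.+1%:R)%:E)%E.
Proof.
move: step; apply: filterS => n stepn; have mesh0 := @euler_mesh_gt0 R n.
have K0 : 0 <= K * euler_mesh n ^+ 2 by rewrite mulr_ge0// sqr_ge0.
have mb : measurable_fun setT b by exact: continuous_measurable_fun.
have [mH le] := euler_maximal PW m_gt0 mesh0 mb c_ge0 l_ge0 K0 delta_x0
  stepn (n.+1 ^ 3).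
split; first exact: mH.
apply: le_trans le _; rewrite lee_fin lerD2l natrX mulrCA ler_wpM2l//.
rewrite /euler_mesh le_eqVlt; apply/orP; left; apply/eqP; field.
by rewrite ?natr1 ?nat1r pnatr_eq0.
Qed.

(** [E] is the inferior limit of the events [hit n]: a limit path that is strictly below [delta] at
    some time brings all fine enough chains below [delta]. The bound on [hit n] passes to the
    increasing union of the [H k]. *)
Lemma limit_maximal : exists E : set T, [/\ measurable E,
  ((f delta)%:E * P E <= (f x0)%:E)%E &
  forall w, continuous (path w) -> ~ E w ->
    forall t, 0 <= t -> delta <= euler_limit b (path w) x0 t].
Proof.
have [N0 _ HN0] := hit_bound.
pose H m := \bigcap_(n in [set n | (N0 + m <= n)%N]) hit n.
have mH k : measurable (H k).
  apply: bigcap_measurableType => n /= Nn.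
  by have [] := HN0 n (leq_trans (leq_addr _ _) Nn).
have fd0 : 0 <= f delta by apply: sumr_ge0 => i _; rewrite mulr_ge0 ?expR_ge0.
exists (\bigcup_k H k); split.
- exact: bigcupT_measurable.
- have Hk k : ((f delta)%:E * P (H k) <= (f x0)%:E)%E.
    apply/lee_addgt0Pr => e e0.
    have [n0 _ Hn0] := near_infty_natSinv_lt (PosNum (divr_gt0 e0 (ltr_wpDl K_ge0 ltr01))).
    pose n := maxn n0 (N0 + k).
    have nk : (N0 + k <= n)%N by exact: leq_maxr.
    have [mhit le] := HN0 n (leq_trans (leq_addr _ _) nk).
    apply: (@le_trans _ _ ((f delta)%:E * P (hit n))%E).
      apply: lee_wpmul2l; first by rewrite lee_fin.
      by apply: le_measure; rewrite ?inE//; exact: bigcap_inf.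
    apply: (le_trans le); rewrite -EFinD lee_fin lerD2l.
    have := Hn0 n (leq_maxl _ _); rewrite /= => lt.
    apply: (@le_trans _ _ ((K + 1) * n.+1%:R^-1)).
      by rewrite ler_wpM2r// lerDl.
    by rewrite mulrC -ler_pdivlMr ?ltW// ltr_wpDl.
  have := @nondecreasing_cvg_mu _ _ _ P H mH (bigcupT_measurable _ mH).
  move=> /(_ _)/cvgeZl cH.
  have {}cH : ((f delta)%:E * P (H k) @[k --> \oo] --> (f delta)%:E * P (\bigcup_k H k))%E.
    apply: cH => // k k' kk'; apply/subsetPset => w Hw n /= k'n; apply: Hw.
    by apply: leq_trans k'n; rewrite leq_add2l.
  rewrite -(cvg_lim _ cH)//; apply: lime_le; last exact: nearW.
  by apply/cvg_ex; eexists; exact: cH.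
- move=> w wc nE t t0; rewrite leNgt; apply/negP => lt; apply: nE.
  have := euler_limit_cvg b_nincr b_bound wc t0.
  move=> cv; have [n1 _ Hn1] := cvgr_lt _ (cv x0) _ lt.
  (* Beyond [n1] the schemes at time [t] are below [delta]; beyond [t] the [n.+1 ^ 3] steps of mesh
     [euler_mesh n] reach time [t]. *)
  exists (maxn n1 (Num.truncn t).+1) => // n /= nn.
  have n1n : (n1 <= n)%N.
    by apply: leq_trans nn; rewrite (leq_trans (leq_maxl _ (Num.truncn t).+1))// leq_addl.
  have tn : ((Num.truncn t).+1 <= n)%N.
    by apply: leq_trans nn; rewrite (leq_trans (leq_maxr n1 _))// leq_addl.
  exists (Num.truncn (t / euler_mesh n)); last exact/ltW/Hn1.
  rewrite -(ler_nat R) natrX.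
  have /andP[+ _] := truncn_div_itv (@euler_mesh_gt0 R n) t0.
  rewrite -ler_pdivlMr ?euler_mesh_gt0// => /le_trans; apply.
  rewrite /euler_mesh invrK [_ ^+ 3]exprS ler_wpM2r ?sqr_ge0//.
  have /andP[_ /ltW] := truncn_itv t0; move=> /le_trans; apply.
  by rewrite ler_nat (leq_trans tn).
Qed.

End limit_maximal.

(** * The hyperbolic cotangent and the superharmonic partial sums *)

Section coth.
Context {R : realType}.
Implicit Types x y : R.

(** This form shows both the monotonicity and the lower bound 1. *)
Lemma cothE x : 0 < x -> coth x = 1 + 2 / (expR (2 * x) - 1).
Proof.
move=> x0; have e1 : 1 < expR x by rewrite -[ltLHS]expR0 ltr_expR.
rewrite /coth expRN (_ : 2 * x = x + x); last by ring.
rewrite expRD; field.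
by rewrite !gt_eqF ?expR_gt0// subr_gt0 -expr2 exprn_egt1.
Qed.

Lemma coth_nincr x y : 0 < x -> x <= y -> coth y <= coth x.
Proof.
move=> x0 xy; rewrite !cothE//; last exact: lt_le_trans xy.
have e1 : 1 < expR (2 * x) by rewrite -[ltLHS]expR0 ltr_expR mulr_gt0.
have xy' : expR (2 * x) <= expR (2 * y) by rewrite ler_expR ler_pM2l.
have hx : 0 < expR (2 * x) - 1 by rewrite subr_gt0.
have hy : 0 < expR (2 * y) - 1 by rewrite subr_gt0 (lt_le_trans e1).
by rewrite lerD2l ler_pM2l// lef_pV2 ?posrE// lerD2r.
Qed.

Lemma coth_gt1 x : 0 < x -> 1 < coth x.
Proof.
move=> x0; rewrite cothE// ltrDl divr_gt0// subr_gt0 -[ltLHS]expR0 ltr_expR.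
by rewrite mulr_gt0.
Qed.

(** With [r = expR (- x) ^+ 2] this brings in the factors [1 - r] and [1 + r] of
    [geometric_odd_sum]. *)
Lemma coth_expR x : 0 < x ->
  (1 - expR (- x) ^+ 2) * coth x = 1 + expR (- x) ^+ 2.
Proof.
move=> x0; have e1 : 1 < expR x by rewrite -[ltLHS]expR0 ltr_expR.
rewrite /coth expRN; field.
by rewrite !gt_eqF ?expR_gt0// subr_gt0 -expr2 exprn_egt1.
Qed.

Lemma continuous_coth x : 0 < x -> {for x, continuous (@coth R)}.
Proof.
move=> x0; have e1 : 1 < expR x by rewrite -[ltLHS]expR0 ltr_expR.
have cE : {for x, continuous (fun y : R => expR (- y))}.
  by apply: continuous_comp; [exact: opp_continuous|exact: continuous_expR].
apply: cvgM.
  by apply: cvgD; [exact: continuous_expR|exact: cE].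
apply: cvgV; last by apply: cvgB; [exact: continuous_expR|exact: cE].
rewrite gt_eqF// subr_gt0 ltr_expR; lra.
Qed.

End coth.

(** From [expR (- v) >= 1 - v], since [(1 - v) (1 + v + 2 v^2) = 1 + v^2 (1 - 2 v)] is at least 1
    for such [v]. *)
Lemma expR_le_quad {R : realType} (v : R) : v <= 2^-1 -> expR v <= 1 + v + 2 * v ^+ 2.
Proof.
move=> v2; have := expR_ge1Dx (- v); rewrite expRN => le.
have e0 := expR_gt0 v.
have e1 : expR v <= (1 - v)^-1.
  by rewrite -[leLHS]invrK lef_pV2 ?posrE ?invr_gt0//; lra.
apply: (le_trans e1); rewrite -[leLHS]mul1r ler_pdivrMr; last by lra.
have : 0 <= v ^+ 2 * (1 - 2 * v) by rewrite mulr_ge0 ?sqr_ge0//; lra.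
rewrite expr2; lra.
Qed.

Section supersolution.
Context {R : realType}.
Variables (d : nat) (m : R).
Hypotheses (hd : (2 <= d)%N) (m_gt0 : 0 < m).

Definition trunc_drift (delta x : R) : R := b0 d m (Num.max x delta).

Let k : R := (d%:R - 1) / (2 * m ^+ 2).

Let i_gt0 : 0 < (2 * m ^+ 2)^-1.
Proof. by rewrite invr_gt0 mulr_gt0// exprn_gt0. Qed.

(** The drift dominates that of dimension 2, for which [supersol] is designed. *)
Let k_ge : (2 * m ^+ 2)^-1 <= k.
Proof.
rewrite /k ler_peMl ?(ltW i_gt0)//.
have : (2 : R) <= d%:R by rewrite ler_nat.
lra.
Qed.

Let k_gt0 : 0 < k.
Proof. exact: lt_le_trans k_ge. Qed.

Lemma b0_ge (x : R) : 0 < x -> k <= b0 d m x.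
Proof. by move=> x0; rewrite /b0 -/k ler_peMr ?(ltW k_gt0)// ltW// coth_gt1. Qed.

Lemma b0_nincr (x y : R) : 0 < x -> x <= y -> b0 d m y <= b0 d m x.
Proof. by move=> x0 xy; rewrite /b0 -/k ler_pM2l// coth_nincr. Qed.

Variable delta : R.
Hypothesis delta_gt0 : 0 < delta.

Let max_gt0 x : 0 < Num.max x delta.
Proof. by rewrite lt_max delta_gt0 orbT. Qed.

Lemma trunc_drift_nincr : {homo trunc_drift delta : x y /~ x <= y}.
Proof.
move=> x y xy; apply: b0_nincr; first exact: max_gt0.
by rewrite ge_max !le_max xy lexx orbT.
Qed.

Lemma trunc_drift_bound x : `|trunc_drift delta x| <= b0 d m delta.
Proof.
rewrite ger0_norm; first by apply: b0_nincr => //; rewrite le_max lexx orbT.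
by apply: le_trans (b0_ge (max_gt0 x)); exact: ltW.
Qed.

Lemma trunc_drift_continuous : continuous (trunc_drift delta).
Proof.
move=> x; apply: cvgM; first exact: cvg_cst.
apply: (@continuous_comp _ _ _ (fun y => Num.max y delta) (@coth R)).
  by apply: continuous_max; [exact: cvg_id|exact: cvg_cst].
exact: continuous_coth.
Qed.

Lemma trunc_driftE x : delta <= x -> trunc_drift delta x = b0 d m x.
Proof. by move=> dx; rewrite /trunc_drift max_l. Qed.

Definition odd_exp (i : nat) : R := i.*2.+1%:R.

(* Partial sum of [- ln (tanh (x / 2)) / 2]. *)
Definition supersol (N : nat) (x : R) : R :=
  \sum_(i < N) (odd_exp i)^-1 * expR (- (odd_exp i * x)).

Lemma odd_exp_gt0 i : 0 < odd_exp i. Proof. by rewrite ltr0n. Qed.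

(* With [r = exp (- 2 x)], this is the action of the generator for [d = 2] on
[supersol N], up to a negative factor. *)
Let geometric_odd_sum (r : R) N :
  (1 + r) * \sum_(i < N) r ^+ i - (1 - r) * \sum_(i < N) odd_exp i * r ^+ i =
  2 * N%:R * r ^+ N.
Proof.
elim: N => [|N IH]; first by rewrite !big_ord0; ring.
rewrite !big_ord_recr/= !mulrDr opprD addrACA IH /odd_exp exprS.
rewrite -[N.*2.+1%:R]natr1 -mul2n natrM -[N.+1%:R]natr1; ring.
Qed.

(** The sum is the generator applied to [supersol N], the weights having cancelled one power of
    [odd_exp i]. With the drift of dimension 2 instead, and after multiplication by [1 - r], what
    remains is a negative multiple of the right-hand side of [geometric_odd_sum]. *)
Let generator_le0 N x : 0 < x ->
  \sum_(i < N) expR (- (odd_exp i * x)) *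
    (- b0 d m x + odd_exp i / (2 * m ^+ 2)) <= 0.
Proof.
move=> x0; set q := expR (- x).
have q0 : 0 < q by exact: expR_gt0.
have q1 : q < 1 by rewrite /q -[ltRHS]expR0 ltr_expR oppr_lt0.
have r1 : 0 < 1 - q ^+ 2 by rewrite subr_gt0 exprn_ilt1// ltW.
have qE i : expR (- (odd_exp i * x)) = q * (q ^+ 2) ^+ i.
  by rewrite -exprM -exprS /odd_exp -mul2n -[in RHS]expRM_natl mulrN.
have bge : (2 * m ^+ 2)^-1 * coth x <= b0 d m x.
  by rewrite /b0 -/k ler_wpM2r// (le_trans ler01)// ltW// coth_gt1.
under eq_bigr do rewrite qE -mulrA.
rewrite -mulr_sumr pmulr_rle0//.
set s1 := \sum_(i < N) (q ^+ 2) ^+ i.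
set s2 := \sum_(i < N) odd_exp i * (q ^+ 2) ^+ i.
rewrite (_ : \sum_(i < N) _ = - b0 d m x * s1 + (2 * m ^+ 2)^-1 * s2); last first.
  rewrite /s1 /s2 !mulr_sumr -big_split/=; apply: eq_bigr => i _; ring.
have s10 : 0 <= s1 by apply: sumr_ge0 => i _; rewrite exprn_ge0// sqr_ge0.
apply: (@le_trans _ _ (- ((2 * m ^+ 2)^-1 * coth x) * s1 + (2 * m ^+ 2)^-1 * s2)).
  by rewrite lerD2r ler_wpM2r// lerN2.
rewrite mulNr addrC -mulrA -mulrBr pmulr_rle0// subr_le0 -(ler_pM2l r1) mulrA.
rewrite coth_expR// -subr_ge0 -/q geometric_odd_sum.
by rewrite !mulr_ge0// exprn_ge0// sqr_ge0.
Qed.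

(** Expanding the last exponential by [expR_le_quad], the term of order [h] is the nonpositive
    generator. The term of order [h ^+ 2] is bounded uniformly in [x], since above [delta] the drift
    is at most its value at [delta]. *)
Lemma supersol_step N : exists2 K, 0 <= K & forall h, 0 < h -> h * K <= 1 ->
  forall x, delta < x ->
  \sum_(i < N) (odd_exp i)^-1 * expR (- (odd_exp i * x)) *
    expR (h * (- (odd_exp i * trunc_drift delta x) + odd_exp i ^+ 2 / (2 * m ^+ 2))) <=
  supersol N x + K * h ^+ 2.
Proof.
pose D := b0 d m delta.
have D0 : 0 < D by exact: lt_le_trans k_gt0 (b0_ge delta_gt0).
pose U : R := odd_exp N * D + odd_exp N ^+ 2 / (2 * m ^+ 2).
have i0 := i_gt0.
have U0 : 0 <= U.
  exact: addr_ge0 (mulr_ge0 (ltW (odd_exp_gt0 N)) (ltW D0)) (mulr_ge0 (sqr_ge0 _) (ltW i0)).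
have KU : 0 <= N%:R * (2 * U ^+ 2).
  exact: mulr_ge0 (ler0n _ _) (mulr_ge0 (ler0n _ 2) (sqr_ge0 U)).
(* [U] bounds every rate [u i]. The second summand collects the quadratic remainders; the first
   makes [h * K <= 1] imply [h * U <= 2^-1], the range of [expR_le_quad]. *)
exists (2 * U + N%:R * (2 * U ^+ 2)); first by rewrite addr_ge0// mulr_ge0.
move=> h h0 hK x dx; have x0 : 0 < x by exact: lt_trans dx.
have hU : h * U <= 2^-1.
  have : h * (2 * U) <= 1.
    by apply: le_trans hK; rewrite ler_pM2l// lerDl.
  lra.
rewrite trunc_driftE ?(ltW dx)//.
pose u (i : nat) := - (odd_exp i * b0 d m x) + odd_exp i ^+ 2 / (2 * m ^+ 2).
have bx : b0 d m x <= D by apply: b0_nincr => //; exact: ltW.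
have bx0 : 0 <= b0 d m x by apply: le_trans (b0_ge x0); exact: ltW.
have ule (i : 'I_N) : `|u i| <= U.
  have oi : odd_exp i <= odd_exp N by rewrite ler_nat ltnS leq_double ltnW.
  have oi0 := odd_exp_gt0 i; have oN0 := odd_exp_gt0 N.
  apply: (le_trans (ler_normD _ _)); rewrite normrN; apply: lerD.
    rewrite ger0_norm; last exact: mulr_ge0 (ltW oi0) bx0.
    by apply: ler_pM => //; exact: ltW.
  rewrite ger0_norm; last exact: mulr_ge0 (sqr_ge0 _) (ltW i0).
  by rewrite ler_pM2r// ler_sqr ?nnegrE ?(ltW oi0) ?(ltW oN0).
pose p i := (odd_exp i)^-1 * expR (- (odd_exp i * x)).
have p01 i : 0 <= p i <= 1.
  have oi0 := odd_exp_gt0 i.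
  have ox0 : 0 <= odd_exp i * x by rewrite mulr_ge0 ?(ltW oi0) ?(ltW x0).
  have io0 : 0 <= (odd_exp i)^-1 by rewrite invr_ge0 (ltW oi0).
  rewrite mulr_ge0 ?expR_ge0//=; apply: mulr_ile1; rewrite ?expR_ge0//.
    by rewrite invf_le1// ler1n.
  by rewrite -[leRHS]expR0 ler_expR oppr_le0.
apply: (@le_trans _ _ (\sum_(i < N) (p i + h * (p i * u i) + 2 * (h * U) ^+ 2))).
  apply: ler_sum => i _; rewrite -/(p i) -/(u i).
  have /andP[pi0 pi1] := p01 i.
  have hu : h * u i <= 2^-1.
    apply: le_trans hU; rewrite ler_pM2l//; exact: le_trans (ler_norm _) (ule i).
  apply: (@le_trans _ _ (p i * (1 + h * u i + 2 * (h * u i) ^+ 2))).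
    by rewrite ler_wpM2l// expR_le_quad.
  have : p i * (h * u i) ^+ 2 <= (h * U) ^+ 2.
    have hUl : `|h * u i| <= h * U by rewrite normrM gtr0_norm// ler_pM2l.
    rewrite -[leRHS]mul1r; apply: ler_pM; rewrite ?sqr_ge0//.
    by rewrite -real_normK ?num_real// ler_sqr ?nnegrE// (le_trans (normr_ge0 _) hUl).
  lra.
rewrite !big_split/= -mulr_sumr sumr_const card_ord -/(supersol N x).
have : \sum_(i < N) p i * u i <= 0.
  have := generator_le0 N x0; congr (_ <= _); apply: eq_bigr => i _.
  rewrite /p /u; field.
  by rewrite gt_eqF//= nat1r pnatr_eq0.

move=> le0; have : h * (\sum_(i < N) p i * u i) <= 0 by rewrite pmulr_rle0.
have : 0 <= 2 * U * h ^+ 2 by exact: mulr_ge0 (mulr_ge0 (ler0n _ 2) U0) (sqr_ge0 h).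
rewrite /supersol -[_ *+ N]mulr_natr => ? ?.
rewrite [(_ + _) * h ^+ 2]mulrDl (_ : 2 * (h * U) ^+ 2 * N%:R = N%:R * (2 * U ^+ 2) * h ^+ 2).
  lra.
ring.
Qed.

End supersolution.

(** * The completed probability space *)

Section completed_probability.
Context {R : realType} {disp : measure_display} {T : measurableType disp}.
Variable P : probability T R.

Lemma sigma_algebra_completed : sigma_algebra setT (completed_algebra_gen P).
Proof.
split.
- by exists set0 => //; exists set0; [exact: negligible_set0|rewrite setU0].
- move=> _ [A mA [N [B [mB B0 NB]] <-]]; exists (~` A `&` ~` B).
    by apply: measurableI; exact: measurableC.
  exists ((~` A `&` ~` N) `&` B).
    by exists B; split => //; exact: subIsetr.
  rewrite setTD setCU; apply/seteqP; split=> w /=.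
    by move=> [[nA nB]|[[? ?] ?]]//; split=> // /NB.
  by move=> [nA nN]; have [Bw|nB] := pselect (B w); [right|left].
- move=> F cF; pose A n := projT1 (cid2 (cF n)).
  have cF' n : measurable (A n) /\ exists2 N, P.-negligible N & A n `|` N = F n.
    by rewrite /A; case: cid2.
  have /choice[N HN] n := let: conj _ (ex_intro2 N h1 h2) := cF' n in
    ex_intro (fun N => P.-negligible N /\ A n `|` N = F n) N (conj h1 h2).
  exists (\bigcup_k A k); first by apply: bigcupT_measurable => k; have [] := cF' k.
  exists (\bigcup_k N k); first by apply: negligible_bigcup => k; have [] := HN k.
  by rewrite -bigcupU; apply: eq_bigcup => // k _; have [_] := HN k.
Qed.

Lemma mu_ext_negligible (N : set T) : P.-negligible N -> mu_ext P N = 0%E.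
Proof.
move=> [B [mB B0 NB]]; apply/eqP; rewrite eq_le; apply/andP; split; last exact: mu_ext_ge0.
rewrite -B0 -(measurable_mu_extE P mB); exact: le_mu_ext.
Qed.

Lemma completed_negligible (N : set T) :
  completed_algebra_gen P N -> mu_ext P N = 0%E -> P.-negligible N.
Proof.
move=> [A mA [N' negN' <-]] N0; apply: negligibleU => //; exists A; split => //.
have : (mu_ext P A <= 0)%E by rewrite -N0; apply: le_mu_ext; exact: subsetUl.
rewrite (measurable_mu_extE P mA) => le0.
by apply/eqP; rewrite eq_le le0 measure_ge0.
Qed.

(** Yields the countable additivity of [mu_ext P] on the completion. A null set splits every set
    additively because its traces have outer measure 0. *)
Lemma completed_sub_caratheodory :
  completed_algebra_gen P `<=` (mu_ext P).-cara.-measurable.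
Proof.
move=> _ [A mA [N negN <-]].
apply: measurableU; first exact: caratheodory_measurable_mu_ext.
apply: le_caratheodory_measurable => X.
rewrite [X in (X + _)%E](_ : _ = 0%E).
  by rewrite add0e; apply: le_mu_ext; exact: subIsetl.
apply/eqP; rewrite eq_le; apply/andP; split; last exact: mu_ext_ge0.
rewrite -(mu_ext_negligible negN).
by apply: le_mu_ext; exact: subIsetr.
Qed.

(* The filtrations only lie in the completion of the sigma-algebra of [T], so
that probabilities are computed on [T] with this larger sigma-algebra. *)
Definition completed_type : Type := g_sigma_algebraType (completed_algebra_gen P).

HB.instance Definition _ := Measurable.on completed_type.

Lemma measurable_completedE (A : set completed_type) :
  measurable A <-> completed_algebra_gen P A.
Proof. by rewrite /measurable/= (sigma_algebra_id sigma_algebra_completed). Qed.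

Definition completed_prob (A : set completed_type) : \bar R := mu_ext P A.

Let completed_prob0 : completed_prob set0 = 0%E. Proof. exact: mu_ext0. Qed.

Let completed_prob_ge0 A : (0 <= completed_prob A)%E. Proof. exact: mu_ext_ge0. Qed.

Let completed_prob_sigma_additive : semi_sigma_additive completed_prob.
Proof.
move=> F mF tF mUF; apply: caratheodory_measure_sigma_additive => //.
- by move=> i; apply/completed_sub_caratheodory/measurable_completedE.
- exact/completed_sub_caratheodory/measurable_completedE.
Qed.

HB.instance Definition _ := isMeasure.Build _ _ _ completed_prob
  completed_prob0 completed_prob_ge0 completed_prob_sigma_additive.

Let completed_probT : completed_prob setT = 1%E.
Proof.
rewrite /completed_prob (measurable_mu_extE P (@measurableT _ T)).
exact: (@probability_setT _ _ _ P).
Qed.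

HB.instance Definition _ := Measure_isProbability.Build _ _ _ completed_prob
  completed_probT.

(** Keeping [W] constant at negative times makes paths that are continuous on the half-line
    continuous on the whole line, as the lemmas on Euler schemes require. *)
Lemma wiener_gaussian_increments (F : R -> set (set T)) (W : R -> T -> R) :
  wiener_wrt P F W ->
  gaussian_increments (completed_prob : probability completed_type R) F
    (fun t => W (Num.max t 0)).
Proof.
move=> [[sF subF monoF] adW _ _ gW iW]; split => //.
- by move=> t t0 A FA; apply/measurable_completedE; exact: subF FA.
- by move=> t t0; rewrite max_l//; apply/measurable_wrtP; [exact: sF|exact: adW].
- move=> s t s0 st A B FA mB; rewrite !max_l//; last exact: le_trans (ltW st).
  by rewrite -gW//; exact: iW.
Qed.

End completed_probability.

Lemma continuous_max0 {R : realType} (f : R -> R) :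
  {within `[0, +oo[, continuous f} -> continuous (fun t : R => f (Num.max t 0)).
Proof.
move=> /subspace_continuousP cf x; set y : R := Num.max (x : R) 0.
have y0 : `[0, +oo[%classic y by rewrite /= in_itv/= andbT le_max lexx orbT.
have cmax : {for x, continuous (fun t : R => Num.max t 0)}.
  by apply: continuous_max; [exact: cvg_id|exact: cvg_cst].
apply: (@cvg_comp _ _ _ (fun t : R => Num.max t 0) f _ _ _ _ (cf _ y0)) => B yB.
have : nbhs x [set t : R | `[0, +oo[%classic (Num.max t 0) -> B (Num.max t 0)] := cmax _ yB.
by apply: filterS => t; apply; rewrite /= in_itv/= andbT le_max lexx orbT.

Qed.

(** * Uniform bound and divergence of the partial sums *)

Section supersol_bounds.
Context {R : realType}.

(** Comparison with a geometric series gives a bound uniform in [N], to be opposed to the divergence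
    in [supersol_dvg]. *)
Lemma supersol_ub N (x : R) : 0 < x -> supersol N x <= (1 - expR (- x))^-1.
Proof.
move=> x0; set q := expR (- x).
have q1 : q < 1 by rewrite /q -[ltRHS]expR0 ltr_expR oppr_lt0.
have q0 : 0 <= q by exact: expR_ge0.
apply: (@le_trans _ _ (\sum_(i < N) q ^+ i)).
  apply: ler_sum => i _; rewrite (@le_trans _ _ (expR (- (@odd_exp R i * x))))//.
    rewrite ler_piMl ?expR_ge0// invf_le1 ?odd_exp_gt0//.
    by rewrite /odd_exp ler1n.
  rewrite /q -expRM_natl ler_expR mulrN lerN2 ler_pM2r// ler_nat.
  by rewrite -addnn -addnS leq_addr.
have q10 : 0 < 1 - q by rewrite subr_gt0.
rewrite -[leRHS]mul1r ler_pdivlMr// mulrC.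
have -> : (1 - q) * \sum_(i < N) q ^+ i = 1 - q ^+ N.
  by rewrite -[RHS]opprB subrX1 -mulNr opprB.
by rewrite lerBlDr lerDl exprn_ge0.
Qed.

(** Chosen so that [odd_exp i * trunc_level N] is at most 1 for all [i <= N]. *)
Definition trunc_level (N : nat) : R := (2 * N.+1%:R)^-1.

Lemma trunc_level_gt0 N : 0 < trunc_level N.
Proof. by rewrite invr_gt0 mulr_gt0. Qed.

Lemma trunc_level_nincr N N' : (N <= N')%N -> trunc_level N' <= trunc_level N.
Proof. by move=> NN'; rewrite lef_pV2 ?posrE ?mulr_gt0// ler_pM2l// ler_nat. Qed.

Lemma trunc_level_lt (e : R) : 0 < e -> \forall N \near \oo, trunc_level N < e.
Proof.
move=> e0; near=> n; apply: (@le_lt_trans _ _ (n.+1%:R^-1)).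
  by rewrite lef_pV2 ?posrE ?mulr_gt0// ler_peMl ?ler0n// ler1n.
by near: n; exact: near_infty_natSinv_lt (PosNum e0).
Unshelve. all: by end_near. Qed.

(** Each exponential is at least [expR (- 1)], so the sum dominates a fixed multiple of the harmonic
    series. *)
Lemma supersol_dvg (A : R) : \forall N \near \oo, A <= supersol N.+1 (trunc_level N).
Proof.
have h0 : {homo series (@harmonic R) : n p / (n <= p)%N >-> n <= p}.
  by apply: nondecreasing_series => n _ _; rewrite harmonic_ge0.
have /cvgryPge/(_ (2 * expR 1 * A)) := nondecreasing_dvgn_lt h0 (@dvg_harmonic R).
apply: filterS => N le; have e0 := expR_gt0 (1 : R).
rewrite -(ler_pM2l (mulr_gt0 (ltr0Sn _ 1) e0)); apply: (le_trans le).
apply: (@le_trans _ _ (series (@harmonic R) N.+1)); first exact: h0.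
rewrite /series/= big_mkord mulr_sumr; apply: ler_sum => i _; rewrite /harmonic/=.
have oi0 := @odd_exp_gt0 R i.
have le1 : @odd_exp R i <= 2 * i.+1%:R.
  by rewrite /odd_exp -natrM ler_nat mul2n doubleS.
have lee : @odd_exp R i * trunc_level N <= 1.
  rewrite ler_pdivrMr ?mulr_gt0// mul1r (le_trans le1)// ler_pM2l// ler_nat.
  exact: ltn_ord.
have : (2 * i.+1%:R)^-1 <= (@odd_exp R i)^-1 by rewrite lef_pV2 ?posrE ?mulr_gt0.
have : expR (- 1) <= expR (- (@odd_exp R i * trunc_level N)).
  by rewrite ler_expR lerN2.
set a := expR (- (_ * _)); set c := (@odd_exp R i)^-1 => ea ci.
rewrite [leRHS](_ : _ = (2 * c) * (expR 1 * a)); last by ring.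
rewrite -[leLHS]mulr1; apply: ler_pM => //.
  by rewrite mulrC -ler_pdivrMr// mulrC -invfM.
by rewrite -(ler_pM2l (expR_gt0 (- 1))) mulr1 mulrA -expRD addNr expR0 mul1r.
Qed.

End supersol_bounds.

(** * Comparison of solutions and pathwise uniqueness *)

Section sde_paths.
Context {R : realType}.
Variables (d : nat) (m : R).
Hypotheses (hd : (2 <= d)%N) (m_gt0 : 0 < m).
Local Notation mu := (@lebesgue_measure R).

Lemma ae_path_gt0 (x : R -> R) : {within `[0, +oo[, continuous x} ->
  (forall t, 0 <= t -> 0 <= x t) -> mu [set t | 0 <= t /\ x t = 0] = 0%E ->
  \forall r \ae mu, 0 <= r -> 0 < x r.
Proof.
move=> cx x0 null; exists [set t | 0 <= t /\ x t = 0]; split => //.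
  rewrite (_ : mkset _ = `[0, +oo[ `&` (fun t : R => x (Num.max t 0)) @^-1` [set 0]).
    apply: measurableI; first exact: measurable_itv.
    rewrite -[X in measurable X]setTI.
    by apply: (continuous_measurable_fun (continuous_max0 cx)) => //; exact: measurable_set1.
  apply/seteqP; split=> t /=; rewrite in_itv/= andbT.
    by move=> [t0 xt]; rewrite max_l.
  by move=> [t0]; rewrite max_l.
move=> t /= /not_implyP[t0 /negP]; rewrite -leNgt => xt; split=> //.
by apply/eqP; rewrite eq_le xt x0.
Qed.

(** While [x'] lies below [x], the drift of [x] is the smaller one. The drift is monotone on
    positive arguments, whence the positivity of the lower path at almost all times. *)
Lemma b0_paths_le (s0 : R) (x x' w : R -> R) :
  (\forall r \ae mu, 0 <= r -> 0 < x' r) ->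
  (forall t, 0 <= t -> mu.-integrable `[0, t] (fun r => (b0 d m (x r))%:E) /\
     x t = s0 + \int[mu]_(r in `[0, t]) b0 d m (x r) + w t) ->
  (forall t, 0 <= t -> mu.-integrable `[0, t] (fun r => (b0 d m (x' r))%:E) /\
     x' t = s0 + \int[mu]_(r in `[0, t]) b0 d m (x' r) + w t) ->
  forall t, 0 <= t -> x t <= x' t.
Proof.
have sub3 (u v v' z : R) : u + v + z - (u + v' + z) = v - v' by ring.
move=> x'0 xE x'E t t0; rewrite -[leRHS]addr0.
apply: (@integral_compare _ (b0 d m \o x) (b0 d m \o x') x x' t 0).
- exact: lexx.
- exact: (xE _ t0).1.
- exact: (x'E _ t0).1.
- move=> s /andP[s0' _]; rewrite (xE _ s0').2 (x'E _ s0').2 /=.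
  exact: sub3.
- move: x'0; apply: filterS => r x'0 /andP[r0 _]; rewrite addr0 => lt.
  by apply: b0_nincr => //; [exact: x'0|exact: ltW].
- by rewrite t0 lexx.
Qed.

Lemma path_linear_lb (s0 : R) (x w : R -> R) :
  (\forall r \ae mu, 0 <= r -> 0 < x r) ->
  (forall t, 0 <= t -> mu.-integrable `[0, t] (fun r => (b0 d m (x r))%:E) /\
     x t = s0 + \int[mu]_(r in `[0, t]) b0 d m (x r) + w t) ->
  forall t, 0 <= t -> s0 + (d%:R - 1) / (2 * m ^+ 2) * t + w t <= x t.
Proof.
move=> x0 xE t t0; have [ib ->] := xE t t0; rewrite lerD2r lerD2l.
set k := _ / _.
have <- : \int[mu]_(r in `[0, t]) k = k * t.
  by rewrite Rintegral_cst//= lebesgue_measure_itv/= lte_fin; case: ltgtP t0 => //= [|<-] _;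
    rewrite ?subr0 ?sube0 ?mulr0.
apply: ae_le_Rintegral => //.
- apply: (@integrable_bounded_itv _ `|k| (fun=> k)) => //.
- move: x0; apply: filterS => r x0; rewrite /= in_itv/= => /andP[r0 _].
  exact: b0_ge hd m_gt0 _ (x0 r0).
Qed.

End sde_paths.

(** The comparison [b0_paths_le] works path by path and is applied in both directions. *)
Lemma pathwise_unique {R : realType} (d : nat) (m s0 : R) :
  (2 <= d)%N -> 0 < m -> pathwise_uniqueness d m s0.
Proof.
move=> hd m0 disp T P F F' W S S' _ [_ cS S0 nS eS] _ [_ cS' S'0 nS' eS'].
move: eS'; apply: filter_app; move: nS nS' eS; apply: filterS3 => w nS nS' eS eS' t t0.
have posS := ae_path_gt0 (cS w) (fun t => S0 t w) nS.
have posS' := ae_path_gt0 (cS' w) (fun t => S'0 t w) nS'.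
apply/eqP; rewrite eq_le; apply/andP; split.
- exact: (b0_paths_le hd m0 posS' eS eS' t0).
- exact: (b0_paths_le hd m0 posS eS' eS t0).
Qed.

(** * Transience *)

Section linear_drift.
Context {R : realType} {disp : measure_display} {T : measurableType disp}.
Variables (P : probability T R) (F : R -> set (set T)) (W : R -> T -> R).
Hypothesis PW : gaussian_increments P F W.
Variables (m k x0 delta : R).
Hypotheses (m_gt0 : 0 < m) (k_gt0 : 0 < k) (delta_x0 : delta < x0).

(* [2 m^2 k] is the rate [l] for which [exp (- l x)] is harmonic for the drift
[k]. *)
Lemma linear_maximal : exists E : set T, [/\ measurable E,
  (P E <= (expR (- (2 * m ^+ 2 * k * (x0 - delta))))%:E)%E &
  forall w, continuous (fun t => m^-1 * W t w) -> ~ E w ->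
    forall t, 0 <= t -> delta <= x0 + k * t + m^-1 * (W t w - W 0 w)].
Proof.
pose l := 2 * m ^+ 2 * k; have l0 : 0 < l by rewrite !mulr_gt0// exprn_gt0.
have bn : {homo (fun _ : R => k) : x y /~ x <= y} by [].
have bc : continuous (fun _ : R => k) by move=> ?; exact: cvg_cst.
have bb (x : R) : `|k| <= `|k| by [].
have [|E [mE PE HE]] := @limit_maximal _ _ _ P F W PW m x0 `|k| (fun=> k) m_gt0 bn bc bb
  1 (fun=> 1) (fun=> l) delta 0 (fun=> ler01) (fun=> ltW l0) (lexx 0) delta_x0.
  near=> n => x _; rewrite !big_ord_recl !big_ord0 !addr0 mul0r addr0.
  rewrite (_ : - (l * k) + l ^+ 2 / (2 * m ^+ 2) = 0) ?mulr0 ?expR0 ?mulr1//.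
  by rewrite /l; field; rewrite gt_eqF.
exists E; split => //.
  move: PE; rewrite !big_ord_recl !big_ord0 !addr0 !mul1r => PE.
  rewrite -(@lee_pmul2l _ (expR (- (l * delta)))%:E)//; last by rewrite lte_fin expR_gt0.
  apply: (le_trans PE); rewrite -EFinM -expRD lee_fin ler_expR.
  by rewrite le_eqVlt; apply/orP; left; apply/eqP; rewrite /l; ring.
move=> w cw nE t t0; apply: le_trans (HE w cw nE t t0) _.
(* For a constant drift the limit of the schemes is the drifted noise itself. *)
have [_ ->] := euler_limit_integral_eq x0 bn bc bb cw t0.
rewrite mulrBr lerD2r lerD2l Rintegral_cst//= lebesgue_measure_itv/= lte_fin.
by case: ltgtP t0 => //= [|<-] _; rewrite ?subr0 ?sube0 ?mulr0.
Unshelve. all: by end_near. Qed.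

End linear_drift.

Lemma hitting_time_pinfty {R : realType} {disp} {T : measurableType disp}
    (S : R -> T -> R) (a : R) (w : T) :
  hitting_time S a w = +oo%E <-> forall t, 0 <= t -> S t w <> a.
Proof.
split=> [oo t t0 Sa|nS].
  have : (hitting_time S a w <= t%:E)%E by apply: ereal_inf_lbound; exists t.
  by rewrite oo leNgt ltry.
rewrite /hitting_time (_ : [set t%:E | t in _] = set0) ?ereal_inf0//.
by apply/seteqP; split=> // y [t [t0 Sa] _]; exact: (nS t).
Qed.

(* Makes the event of hitting [a] a countable combination of events at fixed
times. *)
Lemma hits_approx {R : realType} (x : R -> R) (a : R) :
  {within `[0, +oo[, continuous x} ->
  (exists2 t, 0 <= t & x t = a) <->
  exists n : nat, forall k : nat, exists q : rat,
    0 <= (ratr q : R) <= n%:R /\ `|x (ratr q) - a| < k.+1%:R^-1.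
Proof.
move=> cx; have cx0 := continuous_max0 cx; split=> [[t t0 xt]|[n Hn]].
  have /andP[_ tn] := truncn_itv t0; set n := (Num.truncn t).+1 in tn *.
  exists n => k.
  have /cvgrPdist_lt/(_ (k.+1%:R^-1)) := cx0 t.
  rewrite invr_gt0 ltr0n => /(_ isT)/nbhs_ballP[e /= e0 He].
  have [q] := @rat_in_itvoo R t (Num.min (t + e) n%:R) ltac:(by rewrite lt_min ltrDl e0).
  rewrite in_itv/= lt_min => /andP[tq /andP[qe qn]].
  have q0 : 0 <= ratr q :> R by exact: le_trans (ltW tq).
  exists q; rewrite q0 (ltW qn); split=> //.
  have := He (ratr q); rewrite /ball/= ltr0_norm ?subr_lt0// opprB ltrBlDl => /(_ qe).
  by rewrite !max_l// xt distrC.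
have cx' : {within `[0, n%:R], continuous (fun t => `|x (Num.max t 0) - a|)}.
  apply: continuous_subspaceT => t; apply: cvg_norm.
  by apply: cvgB; [exact: cx0|exact: cvg_cst].
have [c] := EVT_min (ler0n _ n) cx'; rewrite in_itv/= => /andP[c0 cn] Hc.
exists c => //; apply/eqP; rewrite -subr_eq0 -normr_le0; apply/ler_addgt0Pr => e e0.
rewrite add0r; have [k _ Hk] := near_infty_natSinv_lt (PosNum e0).
have [q [/andP[q0 qn] qk]] := Hn k.
apply: (@le_trans _ _ `|x (ratr q) - a|).
  by have := Hc (ratr q); rewrite in_itv/= q0 qn !max_l// => /(_ isT).
by apply/ltW/(lt_trans qk); exact: (Hk k (leqnn k)).
Qed.

Section transience.
Context {R : realType} {disp : measure_display} {T : measurableType disp}.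
Variables (d : nat) (m a s0 : R) (P : probability T R) (F : R -> set (set T)).
Variables (W S : R -> T -> R).
Hypotheses (hd : (2 <= d)%N) (m_gt0 : 0 < m) (a_s0 : a < s0).
Hypotheses (PW : wiener_wrt P F W) (PS : sde_solution d m s0 P F W S).

Let k : R := (d%:R - 1) / (2 * m ^+ 2).

Let k_gt0 : 0 < k.
Proof.
rewrite divr_gt0 ?mulr_gt0 ?exprn_gt0// subr_gt0.
by rewrite ltr1n.
Qed.

Lemma completed_hitting : completed_algebra_gen P [set w | hitting_time S a w = +oo%E].
Proof.
have [[_ subF _] _ _ _ _ _] := PW; have [aS cS _ _ _] := PS.
pose A n i q : set (completed_type P) :=
  if 0 <= (ratr q : R) <= n%:R then [set w | `|S (ratr q) w - a| < i.+1%:R^-1] else set0.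
apply/measurable_completedE.
rewrite (_ : mkset _ = ~` (\bigcup_n \bigcap_i \bigcup_q A n i q)).
  apply: measurableC; apply: bigcupT_measurable => n; apply: bigcapT_measurable => i.
  apply: bigcupT_measurable_rat => q; rewrite /A; case: ifP => // /andP[q0 _].
  apply/measurable_completedE/(subF _ q0)/aS => //.
  exists (ball a (i.+1%:R^-1)); first exact: measurable_ball.
  by rewrite setTI; apply/seteqP; split=> w /=; rewrite /ball/= distrC.
apply/seteqP; split=> w /=.
  move=> /hitting_time_pinfty nh [n _ Hn].
  have [|t t0 St] := (hits_approx a (cS w)).2; last exact: nh St.
  exists n => i; have [q _] := Hn i I; rewrite /A; case: ifP => // qn Sq.
  by exists q.
move=> nA; apply/hitting_time_pinfty => t t0 St; apply: nA.
have [|n Hn] := (hits_approx a (cS w)).1; first by exists t.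
exists n => // i _; have [q [qn Sq]] := Hn i.
by exists q => //; rewrite /A qn.
Qed.

Let lower_bound : \forall w \ae P, [/\ continuous (fun t : R => m^-1 * W (Num.max t 0) w),
  W 0 w = 0 & forall t, 0 <= t -> s0 + k * t + m^-1 * W t w <= S t w].
Proof.
have [_ _ W0 Wc _ _] := PW; have [_ cS S0 nS eS] := PS.
move: eS; apply: filter_app; move: nS W0 Wc; apply: filterS3 => w nS W0 Wc eS.
split=> //.
  move=> t; apply: cvgM; first exact: cvg_cst.
  exact: (continuous_max0 Wc).
have posS := ae_path_gt0 (cS w) (fun t => S0 t w) nS.
exact: (path_linear_lb hd m_gt0 posS eS).
Qed.

Let PW' := wiener_gaussian_increments PW.

(** Outside [E] the solution stays above the midpoint [delta] of [a] and [s0], hence does not meet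
    [a]. If not meeting [a] had probability 0, then [E] would have probability 1, but its bound is
    less than 1. *)
Lemma hitting_pinfty_gt0 : (0 < mu_ext P [set w | hitting_time S a w = +oo%E])%E.
Proof.
pose delta := (a + s0) / 2.
have [ad ds] : a < delta /\ delta < s0 by split; rewrite (midf_lt a_s0).
have [E [mE PE HE]] := linear_maximal PW' m_gt0 k_gt0 ds.
rewrite ltNge; apply/negP => null.
have : (1 <= expR (- (2 * m ^+ 2 * k * (s0 - delta))))%R.
  rewrite -lee_fin; apply: le_trans PE.
  have -> : 1%E = (completed_prob (setT : set (completed_type P))).
    by rewrite probability_setT.
  pose B := [set w | ~ [/\ continuous (fun t : R => m^-1 * W (Num.max t 0) w),
    W 0 w = 0 & forall t, 0 <= t -> s0 + k * t + m^-1 * W t w <= S t w]].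
  have B0 : mu_ext P B = 0%E by apply: mu_ext_negligible; exact: lower_bound.
  rewrite /completed_prob.
  apply: (@le_trans _ _ (mu_ext P (E `|` ([set w | hitting_time S a w = +oo%E] `|` B)))).
    apply: le_mu_ext => w _; have [Ew|nE] := pselect (E w); first by left.
    right; have [Bw|/contrapT[cw W0 lb]] := pselect (B w); first by right.
    left; apply/hitting_time_pinfty => t t0 St; have := lb t t0.
    have := HE w cw nE t t0; rewrite maxxx max_l// W0 subr0 St => le1 le2.
    by have := le_trans le1 le2; rewrite leNgt ad.
  apply: (le_trans (outer_measureU2 _ _ _)); rewrite -[leRHS]adde0 leeD2l//.
  have HB : (mu_ext P [set w | hitting_time S a w = +oo%E] + mu_ext P B <= 0)%E.
    by rewrite B0 adde0.
  exact: le_trans (outer_measureU2 _ _ _) HB.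
rewrite -expR0 ler_expR oppr_ge0 leNgt => /negP; apply.
have sd : 0 < s0 - delta by rewrite subr_gt0.
by do 3 apply: mulr_gt0 => //; exact: exprn_gt0.
Qed.

(** Outside [E L] the noise term is at least [- L.+1%:R - k / 2 * t], which leaves [S] a linear
    growth of slope [k / 2]. The probabilities of the [E L] tend to 0, so almost every point is
    outside one of them. *)
Lemma solution_cvg_pinfty : \forall w \ae P, S t w @[t --> +oo] --> +oo.
Proof.
have k2 : 0 < k / 2 by rewrite divr_gt0.
have lt0 (L : nat) : (- L.+1%:R : R) < 0 by rewrite oppr_lt0.
have /choice[E HE] L := linear_maximal PW' m_gt0 k2 (lt0 L).
have negE : P.-negligible (\bigcap_L E L).
  apply: completed_negligible.
    by apply/measurable_completedE; apply: bigcapT_measurable => L; have [] := HE L.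
  apply/eqP; rewrite eq_le; apply/andP; split; last exact: mu_ext_ge0.
  apply/lee_addgt0Pr => e e0; rewrite add0e.
  pose c := 2 * m ^+ 2 * (k / 2).
  have c0 : 0 < c by do 2 apply: mulr_gt0 => //; exact: exprn_gt0.
  have ce0 : 0 < c * e by rewrite mulr_gt0.
  have [L _ HL] := near_infty_natSinv_lt (PosNum ce0).
  have [_ PE _] := HE L.
  apply: (@le_trans _ _ (mu_ext P (E L))); first by apply: le_mu_ext; exact: bigcap_inf.
  apply: (le_trans PE); rewrite lee_fin add0r opprK -/c.
  have := HL L (leqnn L) => /= /ltW Le.
  have cL0 : 0 < c * L.+1%:R by rewrite mulr_gt0.
  have := expR_ge1Dx (c * L.+1%:R) => cL.
  rewrite expRN; apply: (@le_trans _ _ (c * L.+1%:R)^-1).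
    by rewrite lef_pV2 ?posrE ?expR_gt0//; apply: le_trans cL; rewrite lerDr.
  by rewrite invfM ler_pdivrMl.
have nE : \forall w \ae P, ~ (\bigcap_L E L) w.
  by apply: negligibleS negE => w /= /contrapT.
move: lower_bound nE; apply: filterS2 => w [cw W0 lb] /existsNP[L /not_implyP[_ nEL]].
have [_ _ /(_ w cw nEL) HL] := HE L.
apply/cvgryPge => A; near=> t.
have t0 : 0 <= t by near: t; exact: nbhs_pinfty_ge.
have tA : (A - s0 + L.+1%:R) / (k / 2) <= t by near: t; apply: nbhs_pinfty_ge; exact: num_real.
apply: le_trans (lb t t0).
have := HL t t0; rewrite maxxx max_l// W0 subr0 add0r.
move: tA; rewrite ler_pdivrMr//; lra.
Unshelve. all: by end_near. Qed.

End transience.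

(** * Existence of a strong solution *)

Lemma within_itv_itvcy {R : realType} (f : R -> R) :
  (forall t, 0 <= t -> {within `[0, t], continuous f}) ->
  {within `[0, +oo[, continuous f}.
Proof.
move=> cf; apply/subspace_continuousP => x; rewrite /= in_itv/= andbT => x0.
have x1 : x < x + 1 by rewrite ltrDl.
have /subspace_continuousP/(_ x) := cf (x + 1) (le_trans x0 (ltW x1)).
rewrite /= in_itv/= x0 (ltW x1) => /(_ isT) cx B yB.
have nearB : nbhs x [set t | `[0, x + 1]%classic t -> B (f t)] := cx _ yB.
change (nbhs x [set t | `[0, +oo[%classic t -> B (f t)]).
move: (lt_nbhsl x1) nearB; apply: filterS2 => t /= tx Bt.
rewrite in_itv/= andbT => t0; apply: Bt.
by rewrite in_itv/= t0 ltW.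
Qed.

Section euler_limit_paths.
Context {R : realType}.
Local Notation mu := (@lebesgue_measure R).

Lemma euler_limit_continuous (b w : R -> R) (x0 M : R) :
  {homo b : x y /~ x <= y} -> continuous b -> (forall x, `|b x| <= M) ->
  continuous w -> {within `[0, +oo[, continuous (euler_limit b w x0)}.
Proof.
move=> bn bc bb cw; apply: within_itv_itvcy => T T0.
have yE t t0 := (@euler_limit_integral_eq _ _ _ x0 _ bn bc bb cw t t0).2.
pose I t := \int[mu]_(r in `[0, t]) b (euler_limit b w x0 r).
apply: (@subspace_eq_continuous _ _ _ (fun t => x0 + I t + (w t - w 0))).
  by move=> t; rewrite inE/= in_itv/= => /andP[t0 _]; exact/esym/(yE t t0).
have cI : {within `[0, T], continuous I}.
  apply: parameterized_integral_continuous => //.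
  exact: (euler_limit_integral_eq x0 bn bc bb cw T0).1.
move=> t; apply: cvgD.
  by apply: cvgD; [exact: cvg_cst|exact: cI].
apply: cvgB; last exact: cvg_cst.
exact: (continuous_subspaceT cw).
Qed.

Variables (d : nat) (m : R).
Hypotheses (hd : (2 <= d)%N) (m_gt0 : 0 < m).

(** A path that stays above [delta] also solves the equation truncated at the lower level [delta'],
    whose solution is unique by comparison. *)
Lemma trunc_limit_stable (w : R -> R) (x0 delta delta' : R) :
  0 < delta' -> delta' <= delta -> continuous w ->
  let y := euler_limit (trunc_drift d m delta) w x0 in
  (forall t, 0 <= t -> delta <= y t) ->
  forall t, 0 <= t -> euler_limit (trunc_drift d m delta') w x0 t = y t.
Proof.
move=> d'0 d'd cw y yd t t0; have d0 : 0 < delta by exact: lt_le_trans d'd.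
set y' := euler_limit _ _ _.
have eq e (e0 : 0 < e) := euler_limit_integral_eq x0 (trunc_drift_nincr hd m_gt0 e0)
  (@trunc_drift_continuous _ d m _ e0) (trunc_drift_bound hd m_gt0 e0) cw.
have driftE r : 0 <= r -> trunc_drift d m delta (y r) = trunc_drift d m delta' (y r).
  by move=> r0; rewrite !trunc_driftE ?(le_trans d'd)// yd.
have sub3 (u v v' z : R) : u + v + z - (u + v' + z) = v - v' by ring.
have yE := eq _ d0; have y'E := eq _ d'0; rewrite -/y in yE; rewrite -/y' in y'E.
have bn := trunc_drift_nincr hd m_gt0 d'0.
clearbody y y'; clear eq; move: yE y'E driftE bn.
move: (trunc_drift d m delta) (trunc_drift d m delta') => b b' yE y'E driftE bn.
apply/eqP; rewrite eq_le; apply/andP; split.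
- rewrite -[leRHS]addr0; apply: (@integral_compare _ (b' \o y') (b \o y) _ _ t);
    last by rewrite t0 lexx.
  + exact: lexx.
  + exact: (y'E t t0).1.
  + exact: (yE t t0).1.
  + by move=> s /andP[s0 _]; rewrite (y'E s s0).2 (yE s s0).2; exact: sub3.
  + apply/aeW => r /andP[r0 _]; rewrite addr0 => lt; rewrite /= driftE//.
    exact/bn/ltW.
- rewrite -[leRHS]addr0; apply: (@integral_compare _ (b \o y) (b' \o y') _ _ t);
    last by rewrite t0 lexx.
  + exact: lexx.
  + exact: (yE t t0).1.
  + exact: (y'E t t0).1.
  + by move=> s /andP[s0 _]; rewrite (y'E s s0).2 (yE s s0).2; exact: sub3.
  + apply/aeW => r /andP[r0 _]; rewrite addr0 => lt; rewrite /= driftE//.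
    exact/bn/ltW.
Qed.

End euler_limit_paths.

Section existence.
Context {R : realType} {disp : measure_display} {T : measurableType disp}.
Variables (d : nat) (m s0 : R) (P : probability T R) (W : R -> T -> R).
Hypotheses (hd : (2 <= d)%N) (m_gt0 : 0 < m) (s0_gt0 : 0 < s0).
Hypothesis PW : standard_wiener P W.
Local Notation F := (natural_filtration W).
Local Notation path w := (fun t : R => m^-1 * W (Num.max t 0) w).
Local Notation limit delta w := (euler_limit (trunc_drift d m delta) (path w) s0).

Let PW' := wiener_gaussian_increments PW.

Let trunc_maximal N : trunc_level N < s0 ->
  exists E : set T, [/\ completed_algebra_gen P E,
    ((supersol N.+1 (trunc_level N))%:E * mu_ext P E <=
       ((1 - expR (- s0))^-1)%:E)%E &
    forall w, continuous (path w) -> ~ E w ->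
      forall t, 0 <= t -> trunc_level N <= limit (trunc_level N) w t].
Proof.
set e := trunc_level N => es0; have e0 : 0 < e by exact: trunc_level_gt0.
have [K K0 HK] := supersol_step hd m_gt0 e0 N.+1.
have c0 i : 0 <= (@odd_exp R i)^-1 by rewrite invr_ge0 ltW// odd_exp_gt0.
have l0 i : 0 <= @odd_exp R i by rewrite ltW// odd_exp_gt0.
have [|E [mE PE HE]] := limit_maximal PW' m_gt0 (trunc_drift_nincr hd m_gt0 e0)
  (@trunc_drift_continuous _ d m _ e0) (trunc_drift_bound hd m_gt0 e0)
  (N := N.+1) c0 l0 K0 es0.
  have K1 : 0 < (K + 1)^-1 by rewrite invr_gt0 ltr_wpDl.
  have := @euler_mesh_lt R _ K1; apply: filterS => n mn x ex; apply: HK => //.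
    exact: euler_mesh_gt0.
  rewrite (@le_trans _ _ (euler_mesh n * (K + 1)))//.
    by rewrite ler_wpM2l ?ltW ?euler_mesh_gt0// ltrDl.
  by rewrite -ler_pdivlMr ?mul1r ?ltW// ltr_wpDl.
exists E; split.
- exact/measurable_completedE.
- by apply: le_trans PE _; rewrite lee_fin; exact: supersol_ub.
- exact: HE.
Qed.

Lemma strong_solution : exists S : R -> T -> R,
  sde_solution d m s0 P (completed_filtration P F) W S /\
  \forall w \ae P, forall t : R, 0 <= t -> 0 < S t w.
Proof.
have [N0 _ HN0] := trunc_level_lt s0_gt0.
(* The shift by [N0] puts all truncation levels below the starting point. *)
pose delta N : R := trunc_level (N0 + N).
have delta0 N : 0 < delta N by exact: trunc_level_gt0.
have delta_nincr N N' : (N <= N')%N -> delta N' <= delta N.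
  by move=> NN'; apply: trunc_level_nincr; rewrite leq_add2l.
have /choice[E HE] N := trunc_maximal (HN0 (N0 + N)%N (leq_addr _ _)).
(* The complement of [G] will be negligible, hence belongs to the completed filtration at all times.
   Off [G] the process is the constant [s0], so that continuity and nonnegativity hold for every
   [w]. *)
pose G := [set w | [/\ W 0 w = 0, continuous_path W w & exists N, ~ E N w]].
have cpath w : G w -> continuous (path w).
  move=> [_ cW _] t; apply: cvgM; first exact: cvg_cst.
  exact: (continuous_max0 cW).
have Geq w : G w -> exists N, forall t, 0 <= t ->
    delta N <= limit (delta N) w t /\
    forall N', (N <= N')%N -> limit (delta N') w t = limit (delta N) w t.
  move=> Gw; have [_ _ [N nE]] := Gw; exists N.
  have [_ _ /(_ w (cpath w Gw) nE) HN] := HE N.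
  move=> t t0; split; first exact: HN.
  by move=> N' NN'; apply: trunc_limit_stable => //; [exact: delta_nincr|exact: cpath].
pose Z N t w := if w \in G then limit (delta N) w t else s0.
(* The level from which the truncated solutions agree depends on the whole path; the limit over all
   levels keeps [S] adapted. *)
pose S t w := if w \in G then limn (fun N => limit (delta N) w t) else s0.
have limG w t : G w -> 0 <= t -> limit (delta N) w t @[N --> \oo] --> S t w.
  move=> Gw t0; have [N HN] := Geq w Gw; rewrite /S mem_set//.
  have cv : limit (delta N') w t @[N' --> \oo] --> limit (delta N) w t.
    apply: cvg_near_cst; exists N; first by [].
    move=> N' NN'; exact: ((HN t t0).2 N' NN').
  by rewrite (cvg_lim _ cv).
have SE w : G w -> exists N, forall t, 0 <= t ->
    S t w = limit (delta N) w t /\ delta N <= S t w.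
  move=> Gw; have [N HN] := Geq w Gw; exists N => t t0.
  suff SN : S t w = limit (delta N) w t by split=> //; rewrite SN; exact: (HN t t0).1.
  rewrite /S mem_set//; apply: cvg_lim => //.
  apply: cvg_near_cst; exists N; first by [].
  move=> N' NN'; exact: ((HN t t0).2 N' NN').
have Gae : \forall w \ae P, G w.
  have [_ _ W0 Wc _ _] := PW.
  have negE : P.-negligible (\bigcap_N E N).
    apply: completed_negligible.
      apply/measurable_completedE; apply: bigcapT_measurable => N.
      by apply/measurable_completedE; have [] := HE N.
    apply/eqP; rewrite eq_le; apply/andP; split; last exact: mu_ext_ge0.
    apply/lee_addgt0Pr => e e0; rewrite add0e.
    have q0 : 0 < 1 - expR (- s0) by rewrite subr_gt0 -[ltRHS]expR0 ltr_expR oppr_lt0.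
    (* Once [supersol] exceeds its bound at [s0] divided by [e], the maximal inequality gives [E N]
       outer measure at most [e]. *)
    have [N _ HN] := @supersol_dvg R ((1 - expR (- s0))^-1 / e).
    have A0 : 0 < (1 - expR (- s0))^-1 / e by rewrite divr_gt0// invr_gt0.
    have le := HN (N0 + N)%N (leq_addl _ _).
    have [_ PE _] := HE N.
    apply: (@le_trans _ _ (mu_ext P (E N))); first by apply: le_mu_ext; exact: bigcap_inf.
    rewrite -(@lee_pmul2l _ ((1 - expR (- s0))^-1 / e)%:E)//.
    rewrite -[leRHS]EFinM divfK ?gt_eqF//; apply: le_trans PE.
    by rewrite lee_wpmul2r ?mu_ext_ge0// lee_fin.
  have nE : \forall w \ae P, ~ (\bigcap_N E N) w.
    by apply: negligibleS negE => w /= /contrapT.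
  move: W0 Wc nE; apply: filterS3 => w W0 Wc /existsNP[N /not_implyP[_ nE]].
  by split=> //; exists N.
have Spos w t : G w -> 0 <= t -> 0 < S t w.
  by move=> Gw t0; have [N /(_ t t0)[_]] := SE w Gw; exact: lt_le_trans.
exists S; split; last by move: Gae; apply: filterS => w Gw t; exact: Spos.
split.
- move=> t t0.
  have sFb : sigma_algebra setT (completed_filtration P F t) by exact: smallest_sigma_algebra.
  apply/(measurable_wrtP _ sFb).
  have mG : @measurable _ (g_sigma_algebraType (completed_filtration P F t)) G.
    rewrite -[G]setCK; apply: measurableC; apply: sub_sigma_algebra.
    by apply: sub_sigma_algebra; right; exact: Gae.
  have mif (f : T -> R) : measurable_wrt (completed_filtration P F t) f ->
      measurable_wrt (completed_filtration P F t) (fun w => if w \in G then f w else s0).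
    move=> mf; apply: measurable_fun_ifT => //.
    apply: (measurable_fun_bool true); rewrite setTI [X in measurable X](_ : _ = G)//.
    by apply/seteqP; split=> w /=; [move/set_mem|move/mem_set].
  have mstep N n : measurable_wrt (completed_filtration P F t)
      (fun w => euler_step (trunc_drift d m (delta N)) (path w) s0 (euler_mesh n) t).
    have mb : measurable_fun setT (trunc_drift d m (delta N)).
      by apply: continuous_measurable_fun; exact: trunc_drift_continuous.
    have h0 := @euler_mesh_gt0 R n.
    apply: measurable_wrtS (@measurable_euler _ _ _ _ _ _ PW' m s0 _ _ h0 mb _).
    (* The scheme at time [t] depends on the noise up to the last grid point, which is at most
       [t]. *)
    have /andP[le _] := truncn_div_itv h0 t0.
    apply: subset_trans (gi_mono PW' _ le) _; first by rewrite mulr_ge0// ltW.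
    by move=> A FA; apply: sub_sigma_algebra; left.
  have mZ N : measurable_wrt (completed_filtration P F t) (Z N t).
    apply: (measurable_fun_cvg (fun n => mif _ (mstep N n))) => w _.
    rewrite /Z; case: (boolP (w \in G)) => [/set_mem Gw|_]; last exact: cvg_cst.
    by apply: euler_limit_cvg t0; [exact: trunc_drift_nincr|exact: trunc_drift_bound|exact: cpath].
  apply: (measurable_fun_cvg mZ) => w _; rewrite /Z.
  case: (boolP (w \in G)) => [/set_mem Gw|nG]; first exact: limG.
  by rewrite /S (negbTE nG); exact: cvg_cst.
- move=> w; have [/set_mem Gw|nG] := boolP (w \in G); last first.
    rewrite /continuous_path (_ : (fun t => S t w) = cst s0).
      by apply: continuous_subspaceT => t; exact: cvg_cst.
    by apply/funext => t; rewrite /S (negbTE nG).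
  have [N HN] := SE w Gw.
  apply: (@subspace_eq_continuous _ _ _ (limit (delta N) w)).
    by move=> t; rewrite inE/= in_itv/= andbT => t0; exact/esym/(HN t t0).1.
  apply: euler_limit_continuous; last exact: cpath.
  - exact: trunc_drift_nincr.
  - exact: trunc_drift_continuous.
  - exact: trunc_drift_bound.
- move=> t w t0; have [/set_mem Gw|nG] := boolP (w \in G); first exact/ltW/Spos.
  by rewrite /S (negbTE nG) ltW.
- move: Gae; apply: filterS => w Gw.
  rewrite (_ : mkset _ = set0) ?measure0//; apply/seteqP; split=> // t [t0 St].
  by have := Spos w t Gw t0; rewrite St ltxx.
- move: Gae; apply: filterS => w Gw t t0; have [W0 _ _] := Gw.
  have [N HN] := SE w Gw.
  have [ib eq] := euler_limit_integral_eq s0 (trunc_drift_nincr hd m_gt0 (delta0 N))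
    (@trunc_drift_continuous _ d m _ (delta0 N)) (trunc_drift_bound hd m_gt0 (delta0 N))
    (cpath w Gw) t0.
  have driftE r : r \in `[0, t] -> trunc_drift d m (delta N) (limit (delta N) w r) = b0 d m (S r w).
    by rewrite in_itv/= => /andP[r0 _]; have [<- le] := HN r r0; rewrite trunc_driftE.
  split.
    by apply: eq_integrable ib => // r; rewrite inE/= => r0t; rewrite driftE.
  have intE : \int[@lebesgue_measure R]_(r in `[0, t]) b0 d m (S r w) =
      \int[@lebesgue_measure R]_(r in `[0, t]) trunc_drift d m (delta N) (limit (delta N) w r).
    by apply: eq_Rintegral => r; rewrite inE/= => r0t; rewrite driftE.
  have max00 : Num.max (0 : R) 0 = 0 by exact: max_l.
  by rewrite intE (HN t t0).1 eq max00 W0 mulr0 subr0 (max_l t0).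
Qed.

End existence.

Theorem theorem3p1 (R : realType) (d : nat) (m : R)
    (hd : (2 <= d)%N) (hm : 0 < m) :
  (forall s0 : R, 0 < s0 ->
     strong_existence_pos d m s0 /\ pathwise_uniqueness d m s0) /\
  (forall a s0 : R, 0 < a -> a < s0 ->
   forall (disp : measure_display) (T : measurableType disp)
     (P : probability T R) (F : R -> set (set T)) (W S : R -> T -> R),
   wiener_wrt P F W -> sde_solution d m s0 P F W S ->
   [/\ completed_algebra_gen P [set w | hitting_time S a w = +oo%E],
       (0 < mu_ext P [set w | hitting_time S a w = +oo%E])%E
     & \forall w \ae P, hitting_time S a w = +oo%E ->
         S t w @[t --> +oo] --> +oo]).
Proof.
split=> [s0 s0_gt0|a s0 _ as0 disp T P F W S PW PS].
  split; last exact: pathwise_unique.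
  by move=> disp T P W PW; exact: strong_solution.
split; first exact: completed_hitting PW PS.
- exact: hitting_pinfty_gt0 hd hm as0 PW PS.
- by move: (solution_cvg_pinfty hd hm PW PS); apply: filterS => w cvgS _.
Qed.
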